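(* Let $H\in\mathbb R\setminus\{0\}$ and let $\Phi:\mathcal V(\mathcal D)\to\Lambda\mathrm{SU}_{2,\sigma}$ be an extended frame with mean curvature $H$ and Hopf differential $\alpha$. With $\lambda=e^{\sqrt{-1}t}$, define $\mathfrak f,\mathfrak f^*:\mathcal V(\mathcal D)\to\operatorname{Im}\mathbb H\cong\mathbb R^3$ (for each fixed $t\in\mathbb R$) by $$\mathfrak f=-\frac1H\Big(\Phi^{-1}\partial_t\Phi-\frac{\sqrt{-1}}2\Phi^{-1}\sigma_3\Phi\Big),\qquad\mathfrak f^*=-\frac1H\Big(\Phi^{-1}\partial_t\Phi+\frac{\sqrt{-1}}2\Phi^{-1}\sigma_3\Phi\Big).$$ Then: (1) If $\alpha$ is real valued and $t=0$, then $\mathfrak f$ and $\mathfrak f^*$ are respectively a discrete isothermic parametrized CMC surface and its Christoffel dual isothermic parametrized CMC surface. (2) For any non-zero complex valued labelling $\alpha$, any $t\in\mathbb R$ and the decomposition $\mathcal V(\mathcal D)=\mathcal V(\mathcal G)\sqcup\mathcal V(\mathcal G^* )$, the maps $f=\mathfrak f|_{\mathcal V(\mathcal G)}$ and $f^*=\mathfrak f^*|_{\mathcal V(\mathcal G^* )}$ are respectively a discrete CMC surface and its Christoffel dual CMC surface, i.e. $(f,f^* )$ is a pair of discrete isothermic non-zero constant mean curvature surfaces on $(\mathcal G,\mathcal G^* )$.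
   Context: Graphs. $\mathcal D$ is an even quadrilateral graph (cell decomposition of a simply connected oriented surface into quadrilaterals, all closed loops of even length), decomposed bipartitely as $\mathcal V(\mathcal D)=\mathcal V(\mathcal G)\sqcup\mathcal V(\mathcal G^* )$, where $\mathcal G$ is a cellular decomposition and $\mathcal G^*$ its dual: faces of $\mathcal G$ are the vertices of $\mathcal G^*$, edges of $\mathcal D$ join a vertex of $\mathcal G$ to an incident face of $\mathcal G$, and each quadrilateral $(v_0,v_1,v_2,v_3)$ (cyclic order, $v_0,v_2\in\mathcal V(\mathcal G)$, $v_1,v_3\in\mathcal V(\mathcal G^* )$) corresponds to an edge $e_{02}$ of $\mathcal G$ and its dual edge. Write $f_i=f(v_i)$. If there is a boundary, conditions with sums over a face are imposed only at interior faces. Labelling: a function on edges of $\mathcal D$ independent of edge orientation and equal on opposite edges of each quadrilateral; $\alpha_1=\alpha(v_0v_1)=\alpha(v_3v_2)$, $\alpha_2=\alpha(v_0v_3)=\alpha(v_1v_2)$. Loop group: $\Lambda\mathrm{SU}_{2,\sigma}$ is the group of smooth $\gamma:S^1\to\mathrm{SU}_2$ with $\sigma_3\gamma(-\lambda)\sigma_3^{-1}=\gamma(\lambda)$, $\sigma_3=\mathrm{diag}(1,-1)$. Extended frame with mean curvature $H$ and Hopf differential $\alpha$: $\alpha:\mathcal E(\mathcal D)\to\mathbb C^\times$ is a labelling with $|\sqrt{H\alpha}|\neq1$ on all edges and $\arg\alpha_1\neq\arg\alpha_2$ on every quadrilateral, and $\Phi:\mathcal V(\mathcal D)\to\Lambda\mathrm{SU}_{2,\sigma}$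 satisfies for each oriented edge $\mathfrak e=(v_i,v_j)$ $$\Phi(v_j,\lambda)=\frac1{\kappa(\mathfrak e,\lambda)}U(\mathfrak e,\lambda)\Phi(v_i,\lambda),\quad U=\begin{pmatrix}d&\lambda^{-1}Hu-\lambda\bar\alpha\bar u^{-1}\\\lambda^{-1}\alpha u^{-1}-\lambda H\bar u&\bar d\end{pmatrix},\quad\kappa=\sqrt{\det U}=\sqrt{(1-\lambda^{-2}H\alpha)(1-\lambda^2H\bar\alpha)},$$ for some $u(\mathfrak e)\in\mathbb C\setminus\{0\}$, $d(\mathfrak e)\in\mathbb C$. Quaternions: $\mathbb R^3\cong\operatorname{Im}\mathbb H$, $(x,y,z)\mapsto x\mathbf i+y\mathbf j+z\mathbf k$, with $\mathbf i=-\sqrt{-1}\sigma_1$, $\mathbf j=-\sqrt{-1}\sigma_2$, $\mathbf k=-\sqrt{-1}\sigma_3$ (Pauli matrices); reals correspond to real multiples of $\mathrm{id}$. For (1). A map $\mathfrak f:\mathcal V(\mathcal D)\to\mathbb R^3$ is a discrete isothermic parametrized surface if on every quadrilateral $(\mathfrak f_0-\mathfrak f_1)(\mathfrak f_1-\mathfrak f_2)^{-1}(\mathfrak f_2-\mathfrak f_3)(\mathfrak f_3-\mathfrak f_0)^{-1}=-k_1^2/k_2^2<0$ for a real labelling $k$ ($k_1=k(v_0v_1)$, $k_2=k(v_1v_2)$). A Christoffel dual of it is a discrete isothermic parametrized surface $\mathfrak f^*$ on the same graph with $d\mathfrak f^*(\mathfrak e)=\mu(\mathfrak e)\,d\mathfrak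 f(\mathfrak e)/|d\mathfrak f(\mathfrak e)|^2$ on all edges, where $\mu$ is a real nowhere vanishing labelling such that $(\mathfrak f_0-\mathfrak f_1)(\mathfrak f_1-\mathfrak f_2)^{-1}(\mathfrak f_2-\mathfrak f_3)(\mathfrak f_3-\mathfrak f_0)^{-1}=\mu_1/\mu_2$ on every quadrilateral ($\mu_1=\mu(v_0v_1)$, $\mu_2=\mu(v_1v_2)$). It is a discrete isothermic parametrized CMC surface if there is such a dual $\mathfrak f^*$ and a non-zero constant $H$ with $\|\mathfrak f-\mathfrak f^*\|^2=1/H^2$ at all vertices. For (2). Isothermic surfaces: for adjacent $i,j\in\mathcal V(\mathcal G^* )$ (adjacent faces of $\mathcal G$), $e_{ij}$ is the edge of $\mathcal G$ separating them, oriented as part of the counterclockwise boundary of face $i$; $df_{ij}$ is the difference (end minus start) of $f$ along it, and $df^*_{ij}=f^*_j-f_i^*$. $f:\mathcal V(\mathcal G)\to\mathbb R^3$ is isothermic with Christoffel dual $f^*:\mathcal V(\mathcal G^* )\to\mathbb R^3$ if there are real functions $R_{ij}=R_{ji}$, $R^*_{ij}=R^*_{ji}$ such that the hyperedges $E_{ij}=R_{ij}+df_{ij}$, $E^*_{ij}=R^*_{ij}+df^*_{ij}$ satisfy $\sum_jE_{ij}\cdot E_{ij}^*=0$ for every face $i$ of $\mathcal G$ (sum over the edges of the face). $(f,f^* )$ is a pair of non-zero CMC surfaces if moreover for every quadrilateral $(v_0,v_1,v_2,v_3)$, labelled so that the face $v_1$ lies to the left of the oriented edge $v_0\to v_2$,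 the hyperedge $E_{02}=R_{02}+f_2-f_0$ (i.e. $E_{ij}$ with $i=v_1,j=v_3$) is non-zero and $$f_3^*-f_2=E_{02}^{-1}(f_0-f_1^* )E_{02},\qquad f_3^*-f_0=E_{02}^{-1}(f_2-f_1^* )E_{02}.$$ *)

(* Defs.v *)
From HB Require Import structures.
From mathcomp Require Import all_boot all_order all_algebra.
From mathcomp Require Import all_classical all_reals all_analysis.
From mathcomp Require Import complex.

Set Implicit Arguments.
Unset Strict Implicit.
Unset Printing Implicit Defensive.

Import Order.TTheory GRing.Theory Num.Theory.

Local Open Scope classical_set_scope.
Local Open Scope ring_scope.
Local Open Scope complex_scope.

(* A cell decomposition of an oriented surface into quadrilaterals, as a
   combinatorial map.  A dart is a side of a quadrilateral, oriented so that the
   quadrilateral lies on its left; [nxt] is the next side counterclockwise.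
   [opp x] is the side of the neighbouring quadrilateral glued to [x] (with
   reversed direction); boundary sides are the fixed points of [opp].  The sides
   of the quadrilateral of [x] start at [org x], [org (nxt x)],
   [org (nxt (nxt x))], [org (nxt (nxt (nxt x)))], in counterclockwise order.
   [primal] selects V(G) inside V(D); its complement is V(G^* ).  Multiple edges
   and self-glued quadrilaterals are not excluded. *)

(* [fan opp nxt x y]: the corners of [x] and [y] are related by turning around
   their common vertex through glued sides. *)
Inductive fan (T : Type) (opp nxt : T -> T) (x : T) : T -> Prop :=
| fan_refl : fan opp nxt x x
| fan_cw y : fan opp nxt x y -> opp y <> y -> fan opp nxt x (nxt (opp y))
| fan_ccw y : fan opp nxt x (nxt (opp y)) -> opp y <> y -> fan opp nxt x y.

Record quad_graph := QuadGraph {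
  dart : choiceType;
  vertex : Type;
  nxt : dart -> dart;
  opp : dart -> dart;
  org : dart -> vertex;
  primal : pred vertex;
  nxt4 : forall x, nxt (nxt (nxt (nxt x))) = x;
  nxt2_neq : forall x, nxt (nxt x) <> x;
  oppK : forall x, opp (opp x) = x;
  org_opp : forall x, opp x <> x -> org (opp x) = org (nxt x);
  org_surj : forall v, exists x, org x = v;
  org_fan : forall x y, org x = org y -> fan opp nxt x y;
  org_finite : forall v, finite_set [set x | org x = v];
  primal_nxt : forall x, primal (org (nxt x)) = ~~ primal (org x) }.

Section Paths.
Variable D : quad_graph.

(* [(x, true)] is the dart [x] traversed from [org x] to [org (nxt x)];
   [(x, false)] is its reversal (needed as such on the boundary). *)
Definition oedge := (dart D * bool)%type.
Definition esrc (e : oedge) := if e.2 then org e.1 else org (nxt e.1).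
Definition etgt (e : oedge) := if e.2 then org (nxt e.1) else org e.1.
Definition erev (e : oedge) : oedge := (e.1, ~~ e.2).

Fixpoint walk (v : vertex D) (p : seq oedge) (w : vertex D) : Prop :=
  if p is e :: p' then esrc e = v /\ walk (etgt e) p' w else v = w.

Inductive elementary : seq oedge -> seq oedge -> Prop :=
| elementary_spur e : elementary [:: e; erev e] [::]
| elementary_glue x : opp x <> x ->
    elementary [:: (x, true)] [:: (opp x, false)]
| elementary_face x :
    elementary [:: (x, true); (nxt x, true); (nxt (nxt x), true);
                   (nxt (nxt (nxt x)), true)] [::].

Inductive homotopic (v w : vertex D) : seq oedge -> seq oedge -> Prop :=
| homotopic_refl p : homotopic v w p p
| homotopic_sym p q : homotopic v w p q -> homotopic v w q p
| homotopic_trans p q r :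
    homotopic v w p q -> homotopic v w q r -> homotopic v w p r
| homotopic_step a b p r r' q : elementary r r' ->
    walk v p a -> walk a r b -> walk a r' b -> walk b q w ->
    homotopic v w (p ++ r ++ q) (p ++ r' ++ q).

Definition simply_connected :=
  (forall v w, exists p, walk v p w) /\
  (forall v p, walk v p v -> homotopic v v p [::]).

Definition even_graph := forall v p, walk v p v -> ~~ odd (size p).

Definition interior_vertex (v : vertex D) := forall x, org x = v ->
  opp x <> x /\ opp (nxt (nxt (nxt x))) <> nxt (nxt (nxt x)).

Definition primal_vertex := {v : vertex D | primal v}.
Definition dual_vertex := {v : vertex D | ~~ primal v}.

(* The edge carrying the dart [x] is the class of [x] under [opp]; the opposite
   edge in the quadrilateral of [x] carries [nxt (nxt x)]. *)
Definition labelling (T : Type) (k : dart D -> T) :=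
  forall x, k (opp x) = k x /\ k (nxt (nxt x)) = k x.

End Paths.

Section Loops.
Variable R : realType.
Local Notation C := R[i].

Definition expi (t : R) : C := cos t +i* sin t.

(* Principal argument, in ]-pi, pi]. *)
Definition carg (z : C) : R :=
  xget 0 [set t : R | (- pi < t <= pi) /\ z = `|z| * expi t].

Definition mx2 (a b c d : C) : 'M[C]_2 := \matrix_(i, j)
  if i == 0 then (if j == 0 then a else b) else (if j == 0 then c else d).

Definition sigma1 := mx2 0 1 1 0.
Definition sigma2 := mx2 0 (- 'i%C) 'i%C 0.
Definition sigma3 := mx2 1 0 0 (-1).

Definition smooth (g : R -> C) := forall n t,
  derivable (derive1n n (fun s => complex.Re (g s))) t 1 /\
  derivable (derive1n n (fun s => complex.Im (g s))) t 1.

Definition cderive (g : R -> C) (t : R) : C :=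
  derive1 (fun s => complex.Re (g s)) t +i* derive1 (fun s => complex.Im (g s)) t.

(* A loop is given by its values on the unit circle; other values of [gamma]
   are irrelevant. *)
Definition loopSU2 (gamma : C -> 'M[C]_2) :=
  [/\ forall i j, smooth (fun t => gamma (expi t) i j),
      forall l, `|l| = 1 -> gamma l \is unitarymx /\ \det (gamma l) = 1
    & forall l, `|l| = 1 ->
        sigma3 *m gamma (- l) *m invmx sigma3 = gamma l].

Definition frame_mx (H : R) (alpha u d l : C) : 'M[C]_2 :=
  mx2 d                              (l^-1 * H%:C * u - l * alpha^*%C / u^*%C)
      (l^-1 * alpha / u - l * H%:C * u^*%C)                           (d^*%C).

(* The product is a nonnegative real for `|l| = 1, and [sqrtC] is then its
   nonnegative square root. *)
Definition kappa2 (H : R) (alpha l : C) : C :=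
  (1 - l ^- 2 * H%:C * alpha) * (1 - l ^+ 2 * H%:C * alpha^*%C).
Definition kappa (H : R) (alpha l : C) : C := sqrtC (kappa2 H alpha l).

Definition extended_frame (D : quad_graph) (H : R) (alpha : dart D -> C)
    (Phi : vertex D -> C -> 'M[C]_2) :=
  [/\ labelling alpha,
      forall x, alpha x != 0 /\ `|sqrtC (H%:C * alpha x)| != 1,
      forall x, carg (alpha x) != carg (alpha (nxt x)),
      forall v, loopSU2 (Phi v)
    & forall e : oedge D, exists u d : C, u != 0 /\
        forall l, `|l| = 1 ->
          \det (frame_mx H (alpha e.1) u d l) = kappa2 H (alpha e.1) l /\
          Phi (etgt e) l = (kappa H (alpha e.1) l)^-1 *:
            (frame_mx H (alpha e.1) u d l *m Phi (esrc e) l)].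

Definition dframe (g : C -> 'M[C]_2) (t : R) : 'M[C]_2 :=
  \matrix_(i, j) cderive (fun s => g (expi s) i j) t.

Definition sym_surface (H : R) (g : C -> 'M[C]_2) (t : R) : 'M[C]_2 :=
  - (H%:C)^-1 *: (invmx (g (expi t)) *m dframe g t
                  - ('i%C / 2) *: (invmx (g (expi t)) *m sigma3 *m g (expi t))).

Definition sym_surface_dual (H : R) (g : C -> 'M[C]_2) (t : R) : 'M[C]_2 :=
  - (H%:C)^-1 *: (invmx (g (expi t)) *m dframe g t
                  + ('i%C / 2) *: (invmx (g (expi t)) *m sigma3 *m g (expi t))).

End Loops.

(* The quaternions are the real span of the identity and -i sigma1, -i sigma2,
   -i sigma3 in 'M_2, so quaternionic product and inverse are [*m] and [invmx].
   The library norm on row vectors is the sup norm; [sqnorm] is the squared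
   Euclidean norm. *)

Section Surfaces.
Variables (R : realType) (D : quad_graph).
Local Notation C := R[i].
Local Notation vec := 'rV[R]_3.

Definition qreal (r : R) : 'M[C]_2 := r%:C%:M.

Definition qim (x : vec) : 'M[C]_2 :=
  (x 0 0)%:C *: (- 'i%C *: sigma1 R) + (x 0 1)%:C *: (- 'i%C *: sigma2 R)
  + (x 0 2%:R)%:C *: (- 'i%C *: sigma3 R).

Definition sqnorm (x : vec) : R := \sum_(i < 3) x 0 i ^+ 2.

Definition cross_ratio (f : vertex D -> vec) (x : dart D) : 'M[C]_2 :=
  let f0 := f (org x) in let f1 := f (org (nxt x)) in
  let f2 := f (org (nxt (nxt x))) in
  let f3 := f (org (nxt (nxt (nxt x)))) in
  qim (f0 - f1) *m invmx (qim (f1 - f2)) *m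
  qim (f2 - f3) *m invmx (qim (f3 - f0)).

Definition isothermic_param (f : vertex D -> vec) :=
  exists2 k : dart D -> R, labelling k &
  forall x, primal (org x) ->
    cross_ratio f x = qreal (- (k x ^+ 2 / k (nxt x) ^+ 2)) /\
    - (k x ^+ 2 / k (nxt x) ^+ 2) < 0.

Definition christoffel_dual_param (f fs : vertex D -> vec) :=
  isothermic_param fs /\
  exists mu : dart D -> R,
    [/\ labelling mu, forall x, mu x != 0,
        forall x, let df := f (org (nxt x)) - f (org x) in
          fs (org (nxt x)) - fs (org x) = (mu x / sqnorm df) *: df
      & forall x, primal (org x) ->
          cross_ratio f x = qreal (mu x / mu (nxt x))].

(* [f] is an isothermic parametrized CMC surface, as witnessed by the Christoffel
   dual [fs] and the constant [H]. *)
Definition cmc_param (H : R) (f fs : vertex D -> vec) :=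
  [/\ H != 0, isothermic_param f, christoffel_dual_param f fs
    & forall v, sqnorm (f v - fs v) = 1 / H ^+ 2].

Definition ext0 (P : pred (vertex D)) (f : {v | P v} -> vec)
  (v : vertex D) : vec := oapp f 0 (insub v).

Section Pairs.
Variables (f : primal_vertex D -> vec) (fs : dual_vertex D -> vec).

Let F : vertex D -> vec := ext0 f.
Let Fs : vertex D -> vec := ext0 fs.

(* For a dart [x] starting at a vertex of G^* , set i = org x and
   j = org (nxt (nxt x)).  The edge e_ij of G, oriented with i on its left, goes
   from org (nxt x) to org (nxt (nxt (nxt x))); [nxt (nxt x)] describes e_ji.
   Only such darts are used below. *)
Definition hyperedge (r : dart D -> R) (x : dart D) : 'M[C]_2 :=
  qreal (r x) + qim (F (org (nxt (nxt (nxt x)))) - F (org (nxt x))).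

Definition hyperedge_dual (rs : dart D -> R) (x : dart D) : 'M[C]_2 :=
  qreal (rs x) + qim (Fs (org (nxt (nxt x))) - Fs (org x)).

Definition isothermic_pair (r rs : dart D -> R) :=
  [/\ forall x, ~~ primal (org x) -> r (nxt (nxt x)) = r x,
      forall x, ~~ primal (org x) -> rs (nxt (nxt x)) = rs x
    & forall i : dual_vertex D, interior_vertex (val i) ->
        \sum_(x \in [set x | org x = val i])
          (hyperedge r x *m hyperedge_dual rs x) = 0].

(* The quadrilateral (v0, v1, v2, v3) with v1 on the left of v0 -> v2 is read
   off a dart [x] at v1 as v1 = org x, v0 = org (nxt x),
   v3 = org (nxt (nxt x)), v2 = org (nxt (nxt (nxt x))). *)
Definition cmc_pair :=
  exists r rs : dart D -> R, isothermic_pair r rs /\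
  forall x, ~~ primal (org x) ->
    let E := hyperedge r x in
    let f0 := F (org (nxt x)) in
    let f2 := F (org (nxt (nxt (nxt x)))) in
    let f1s := Fs (org x) in
    let f3s := Fs (org (nxt (nxt x))) in
    [/\ E != 0,
        qim (f3s - f2) = invmx E *m qim (f0 - f1s) *m E
      & qim (f3s - f0) = invmx E *m qim (f2 - f1s) *m E].

End Pairs.
End Surfaces.

(* Main.v *)
Require Import Defs.
From HB Require Import structures.
From mathcomp Require Import all_boot all_order all_algebra.
From mathcomp Require Import all_classical all_reals all_analysis.
From mathcomp Require Import complex.
From mathcomp Require Import ring lra.

Set Implicit Arguments.
Unset Strict Implicit.
Unset Printing Implicit Defensive.

Import Order.TTheory GRing.Theory Num.Theory.

Local Open Scope classical_set_scope.
Local Open Scope ring_scope.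
Local Open Scope complex_scope.

(* On an edge of D joining a point f* to a point f, the Sym formula makes f - f*
   equal to rho + (sqrt(-1)/H) (1 - 2 T), where rho is a real function of the label and T is
   the logarithmic derivative, in the squared spectral parameter, of an edge matrix
   that is linear in that parameter.  Comparing leading coefficients in the
   flatness condition of a quadrilateral gives T_03 T_10 = T_23 T_12, whereas
   closing of the surfaces gives T_03 + T_10 = T_23 + T_12.  Put a = f_0 - f*_1,
   b = f_2 - f*_1, a' = f*_3 - f_0, b' = f*_3 - f_2, and let rho, rho' be the
   values of rho for the labels of (v_0 v_1) and (v_1 v_2).  Eliminating the T's gives
   E b' = a E and E a' = b E for E = (rho' - rho) + b - a, the CMC condition with
   R = rho' - rho.  With R* = rho' + rho it implies
   E E* = (b + rho')^2 - (a + rho)^2, which telescopes around a face.  For real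
   alpha and t = 0, rho vanishes and |a|^2 = 1/H^2 + mu, so the same identity reads
   (f_2 - f_0) (f*_3 - f*_1) = mu_1 - mu_2, and with df* = mu df / |df|^2 this is
   equivalent to the cross ratio condition. *)

Lemma sum2E (V : nmodType) (F : 'I_2 -> V) : \sum_i F i = F 0 + F 1.
Proof. by rewrite !big_ord_recl big_ord0 addr0; congr (_ + F _); apply/val_inj. Qed.

Section Conjugation.
Variable R : realType.
Local Notation C := R[i].
Implicit Types (x y : C).

Lemma conjcD x y : (x + y)^*%C = x^*%C + y^*%C. Proof. exact: rmorphD. Qed.
Lemma conjcM x y : (x * y)^*%C = x^*%C * y^*%C. Proof. exact: rmorphM. Qed.
Lemma conjcN x : (- x)^*%C = - x^*%C. Proof. exact: rmorphN. Qed.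
Lemma conjcV x : (x^-1)^*%C = (x^*%C)^-1. Proof. exact: conjc_inv. Qed.
Lemma conjcR (r : R) : (r%:C)^*%C = r%:C. Proof. by rewrite /= oppr0. Qed.
Lemma conjci : 'i%C^*%C = - 'i%C :> C.
Proof. by congr (_ +i* _); rewrite /= oppr0. Qed.
Lemma conjc_1 : 1^*%C = 1 :> C. Proof. exact: rmorph1. Qed.
Lemma conjcKK x : x^*%C^*%C = x. Proof. exact: conjcK. Qed.

Lemma conjcX x n : (x ^+ n)^*%C = x^*%C ^+ n. Proof. exact: rmorphXn. Qed.

Definition conjcE := (conjcX, conjcD, conjcM, conjcN, conjcV, conjcR, conjci, conjc_1, conjcKK).

Implicit Types (r s : R).
Lemma realcD r s : (r + s)%:C = r%:C + s%:C. Proof. exact: rmorphD. Qed.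
Lemma realcN r : (- r)%:C = - r%:C. Proof. exact: rmorphN. Qed.
Lemma realcM r s : (r * s)%:C = r%:C * s%:C. Proof. exact: rmorphM. Qed.
Lemma realcX r n : (r ^+ n)%:C = r%:C ^+ n. Proof. exact: rmorphXn. Qed.
Lemma realcV r : (r^-1)%:C = r%:C^-1. Proof. exact: fmorphV. Qed.
Lemma realc_nat n : n%:R%:C = n%:R :> C. Proof. exact: rmorph_nat. Qed.
Lemma realc1 : 1%:C = 1 :> C. Proof. by []. Qed.

End Conjugation.

Section Matrices.
Variable R : realType.
Local Notation C := R[i].
Implicit Types (a b c d k : C) (M N : 'M[C]_2).

Lemma mx2P M N : M 0 0 = N 0 0 -> M 0 1 = N 0 1 -> M 1 0 = N 1 0 ->
  M 1 1 = N 1 1 -> M = N.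
Proof.
move=> h00 h01 h10 h11; apply/matrixP => i j.
have two (k : 'I_2) : k = 0 \/ k = 1.
  by case: k => -[|[|//]] h; [left|right]; exact/val_inj.
by case: (two i) => ->; case: (two j) => ->.
Qed.

Lemma mx2E M : M = mx2 (M 0 0) (M 0 1) (M 1 0) (M 1 1).
Proof. by apply: mx2P; rewrite mxE. Qed.

Lemma mx2_inj a b c d a' b' c' d' : mx2 a b c d = mx2 a' b' c' d' ->
  [/\ a = a', b = b', c = c' & d = d'].
Proof.
move=> h; move: (congr1 (fun M : 'M[C]_2 => M 0 0) h) (congr1 (fun M : 'M[C]_2 => M 0 1) h)
  (congr1 (fun M : 'M[C]_2 => M 1 0) h) (congr1 (fun M : 'M[C]_2 => M 1 1) h).
by rewrite !mxE.
Qed.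

Lemma mul_mx2 a b c d a' b' c' d' : mx2 a b c d *m mx2 a' b' c' d' =
  mx2 (a * a' + b * c') (a * b' + b * d') (c * a' + d * c') (c * b' + d * d').
Proof. by apply: mx2P; rewrite !mxE sum2E !mxE. Qed.

Lemma add_mx2 a b c d a' b' c' d' : mx2 a b c d + mx2 a' b' c' d' =
  mx2 (a + a') (b + b') (c + c') (d + d').
Proof. by apply: mx2P; rewrite !mxE. Qed.

Lemma opp_mx2 a b c d : - mx2 a b c d = mx2 (- a) (- b) (- c) (- d).
Proof. by apply: mx2P; rewrite !mxE. Qed.

Lemma scale_mx2 k a b c d : k *: mx2 a b c d = mx2 (k * a) (k * b) (k * c) (k * d).
Proof. by apply: mx2P; rewrite !mxE. Qed.

Lemma scalar_mx2 k : k%:M = mx2 k 0 0 k.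
Proof. by apply: mx2P; rewrite !mxE. Qed.

Lemma det_mx2E M : \det M = M 0 0 * M 1 1 - M 0 1 * M 1 0.
Proof.
rewrite (expand_det_row _ 0) sum2E /cofactor !det_mx11 !mxE /= expr0 mul1r expr1.
by rewrite mulN1r mulrN; congr (_ * M _ _ - _ * M _ _); exact/val_inj.
Qed.

Lemma det_mx2 a b c d : \det (mx2 a b c d) = a * d - b * c.
Proof. by rewrite det_mx2E !mxE. Qed.

Definition mx2E_rules :=
  (scalar_mx2, scale_mx2, add_mx2, opp_mx2, mul_mx2, det_mx2).

Lemma invmx2 M : \det M != 0 ->
  invmx M = (\det M)^-1 *: mx2 (M 1 1) (- M 0 1) (- M 1 0) (M 0 0).
Proof.
move=> h; have uM : M \in unitmx by rewrite unitmxE unitfE.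
rewrite -[RHS]mul1mx -(mulVmx uM) -[LHS]mulmx1 -mulmxA; congr (_ *m _).
rewrite -scalemxAr {2}(mx2E M) !mx2E_rules; move: h; rewrite det_mx2E => h.
by congr mx2; field.
Qed.

End Matrices.

(** * Derivatives of complex and matrix valued functions *)

Section ComplexDerivative.
Variable R : realType.
Local Notation C := R[i].
Implicit Types (f g : R -> C) (t : R) (a b c d : C).

Definition is_cderive f t d :=
  is_derive t 1 (fun s => complex.Re (f s)) (complex.Re d) /\
  is_derive t 1 (fun s => complex.Im (f s)) (complex.Im d).

Lemma is_cderiveE f t d : is_cderive f t d -> cderive f t = d.
Proof.
case=> hRe hIm; rewrite /cderive !derive1E.
by rewrite (@derive_val _ _ _ _ _ _ _ hRe) (@derive_val _ _ _ _ _ _ _ hIm); case: d {hRe hIm}.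
Qed.

Lemma is_cderive_unique f t c d :
  is_cderive f t c -> is_cderive f t d -> c = d.
Proof. by move=> /is_cderiveE <- /is_cderiveE. Qed.

Lemma smooth_is_cderive f t : smooth f -> is_cderive f t (cderive f t).
Proof.
move=> /(_ 0%N t)[hRe hIm]; rewrite /cderive !derive1E.
by split; [exact: DeriveDef hRe _ | exact: DeriveDef hIm _].
Qed.

Lemma is_cderive_cst c t : is_cderive (fun=> c) t 0.
Proof. by split; apply: is_derive_cst. Qed.

Lemma is_cderiveD f g t c d : is_cderive f t c -> is_cderive g t d ->
  is_cderive (fun s => f s + g s) t (c + d).
Proof.
move=> [fR fI] [gR gI]; split.
- rewrite (_ : (fun s => _) = (fun s => complex.Re (f s)) \+ (fun s => complex.Re (g s))).
    by rewrite raddfD; exact: is_deriveD.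
  by apply/funext => s; rewrite raddfD.
- rewrite (_ : (fun s => _) = (fun s => complex.Im (f s)) \+ (fun s => complex.Im (g s))).
    by rewrite raddfD; exact: is_deriveD.
  by apply/funext => s; rewrite raddfD.
Qed.

Lemma is_cderiveM f g t c d : is_cderive f t c -> is_cderive g t d ->
  is_cderive (fun s => f s * g s) t (c * g t + f t * d).
Proof.
move=> [fR fI] [gR gI]; split.
- rewrite (_ : (fun s => _) = (fun s => complex.Re (f s)) * (fun s => complex.Re (g s))
    - (fun s => complex.Im (f s)) * (fun s => complex.Im (g s))); last first.
    by apply/funext => s; rewrite !fctE; case: (f s) (g s) => ? ? [].
  apply: (is_derive_eq (is_deriveB (is_deriveM fR gR) (is_deriveM fI gI))).
  case: c d (f t) (g t) {fR fI gR gI} => ? ? [? ?] [? ?] [? ?] /=.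
  by rewrite /GRing.scale /=; ring.
- rewrite (_ : (fun s => _) = (fun s => complex.Re (f s)) * (fun s => complex.Im (g s))
    + (fun s => complex.Im (f s)) * (fun s => complex.Re (g s))); last first.
    apply/funext => s; rewrite !fctE; case: (f s) (g s) => ? ? [] ? ? /=.
    by rewrite [X in _ + X]mulrC.
  apply: (is_derive_eq (is_deriveD (is_deriveM fR gI) (is_deriveM fI gR))).
  case: c d (f t) (g t) {fR fI gR gI} => ? ? [? ?] [? ?] [? ?] /=.
  by rewrite /GRing.scale /=; ring.
Qed.

Lemma is_cderiveZ c f t d : is_cderive f t d ->
  is_cderive (fun s => c * f s) t (c * d).
Proof.
move=> hf; have := is_cderiveM (is_cderive_cst c t) hf.
by rewrite mul0r add0r.
Qed.

Lemma is_cderive_conj f t d : is_cderive f t d ->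
  is_cderive (fun s => (f s)^*%C) t d^*%C.
Proof.
move=> [fR fI]; split.
  rewrite (_ : (fun s => _) = (fun s => complex.Re (f s))).
    by case: d fR {fI}.
  by apply/funext => s; case: (f s).
rewrite (_ : (fun s => _) = - (fun s => complex.Im (f s))).
  by case: d fI {fR} => ? ? fI; exact: is_deriveN.
by apply/funext => s; rewrite !fctE; case: (f s).
Qed.

Lemma is_cderive_real (f : R -> R) t (d : R) : is_derive t 1 f d ->
  is_cderive (fun s => (f s)%:C) t d%:C.
Proof. by move=> hf; split => //=; exact: is_derive_cst. Qed.

Lemma is_cderive_expi t : is_cderive (@expi R) t ('i%C * expi t).
Proof.
split.
  by rewrite /expi /=; apply: is_derive_eq; rewrite mul0r mul1r sub0r.
by rewrite /expi /=; apply: is_derive_eq; rewrite mul0r mul1r add0r.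
Qed.

Lemma norm_expi t : `|expi t| = 1.
Proof. by rewrite normc_def /= cos2Dsin2 sqrtr1. Qed.

Lemma expi_neq0 t : expi t != 0.
Proof. by rewrite -normr_eq0 norm_expi oner_eq0. Qed.

Definition is_mderive (M : R -> 'M[C]_2) t (M' : 'M[C]_2) :=
  forall i j, is_cderive (fun s => M s i j) t (M' i j).

Lemma is_mderive_unique (M : R -> 'M[C]_2) t (M' M'' : 'M[C]_2) :
  is_mderive M t M' -> is_mderive M t M'' -> M' = M''.
Proof. by move=> h h'; apply/matrixP => i j; exact: is_cderive_unique. Qed.

Lemma is_mderiveM (M N : R -> 'M[C]_2) t (M' N' : 'M[C]_2) :
  is_mderive M t M' -> is_mderive N t N' ->
  is_mderive (fun s => M s *m N s) t (M' *m N t + M t *m N').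
Proof.
move=> hM hN i j; rewrite (_ : (fun s => _) = fun s =>
  M s i 0 * N s 0 j + M s i 1 * N s 1 j); last first.
  by apply/funext => s; rewrite !mxE sum2E.
rewrite !mxE !sum2E addrACA.
by apply: is_cderiveD; apply: is_cderiveM.
Qed.

Lemma is_mderiveZ (k : R -> C) (M : R -> 'M[C]_2) t k' (M' : 'M[C]_2) :
  is_cderive k t k' -> is_mderive M t M' ->
  is_mderive (fun s => k s *: M s) t (k' *: M t + k t *: M').
Proof.
move=> hk hM i j; rewrite (_ : (fun s => _) = fun s => k s * M s i j); last first.
  by apply/funext => s; rewrite !mxE.
by rewrite !mxE; apply: is_cderiveM.
Qed.

End ComplexDerivative.

Section Quaternions.
Variable R : realType.
Local Notation C := R[i].
Implicit Types (x y : 'rV[R]_3) (r : R).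

Lemma qimE x : qim x = mx2 (- 'i%C * (x 0 2%:R)%:C) (- 'i%C * (x 0 0)%:C - (x 0 1)%:C)
  (- 'i%C * (x 0 0)%:C + (x 0 1)%:C) ('i%C * (x 0 2%:R)%:C).
Proof.
have ii : 'i%C * 'i%C = -1 :> C by rewrite -expr2 sqr_i.
rewrite /qim /sigma1 /sigma2 /sigma3 !mx2E_rules; congr mx2; ring: ii.
Qed.

Lemma qim0 : qim (0 : 'rV[R]_3) = 0.
Proof. by rewrite qimE; apply: mx2P; rewrite !mxE ?rmorph0; ring. Qed.

Lemma qimB x y : qim (x - y) = qim x - qim y.
Proof. by rewrite !qimE !mx2E_rules !mxE !rmorphB /=; congr mx2; ring. Qed.

Lemma qimZ r x : qim (r *: x) = r%:C *: qim x.
Proof. by rewrite !qimE !mx2E_rules !mxE !rmorphM /=; congr mx2; ring. Qed.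

Lemma qim_inj : injective (@qim R).
Proof.
move=> x y; rewrite !qimE => /mx2_inj[h0 h1 _ _].
apply/rowP => i; move: h0 h1 => /(congr1 (@complex.Im R)) /= h2.
move=> /[dup] /(congr1 (@complex.Re R)) /= h1 /(congr1 (@complex.Im R)) /= h0.
case: i => -[|[|[|//]]] h.
- by rewrite (_ : Ordinal h = 0); [lra|exact/val_inj].
- by rewrite (_ : Ordinal h = 1); [lra|exact/val_inj].
- by rewrite (_ : Ordinal h = 2%:R); [lra|exact/val_inj].
Qed.

Lemma det_qim x : \det (qim x) = (sqnorm x)%:C.
Proof.
have ii : 'i%C * 'i%C = -1 :> C by rewrite -expr2 sqr_i.
rewrite qimE det_mx2 /sqnorm !big_ord_recl big_ord0 addr0 !rmorphD !rmorphXn /=.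
rewrite (_ : lift ord0 ord0 = 1 :> 'I_3); last exact/val_inj.
rewrite (_ : lift ord0 (lift ord0 ord0) = 2%:R :> 'I_3); last exact/val_inj.
ring: ii.
Qed.

Lemma qim_sqr x : qim x *m qim x = (- (sqnorm x)%:C)%:M.
Proof. by rewrite -det_qim !qimE !mx2E_rules; congr mx2; ring. Qed.

Lemma sqnorm_ge0 x : 0 <= sqnorm x.
Proof. by apply: sumr_ge0 => i _; exact: sqr_ge0. Qed.

Lemma sqnorm_eq0 x : (sqnorm x == 0) = (x == 0).
Proof.
apply/idP/eqP => [|->]; last first.
  by rewrite /sqnorm big1// => i _; rewrite mxE expr0n.
rewrite psumr_eq0 => [/allP h|i _]; last exact: sqr_ge0.
apply/rowP => i; rewrite mxE; apply/eqP.
by have := h i; rewrite mem_index_enum sqrf_eq0 => /(_ isT).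
Qed.

Lemma det_quat r x : \det (qreal r + qim x) = (r ^+ 2 + sqnorm x)%:C.
Proof.
rewrite rmorphD rmorphXn /= -det_qim qimE /qreal !mx2E_rules; ring.
Qed.

Lemma det_quat_neq0 r x : qreal r + qim x != 0 -> \det (qreal r + qim x) != 0.
Proof.
apply: contraNN; rewrite det_quat (inj_eq (@complexI R)) => h.
have := h; rewrite paddr_eq0 ?sqr_ge0 ?sqnorm_ge0// sqrf_eq0 sqnorm_eq0.
by move=> /andP[/eqP-> /eqP->]; rewrite qim0 addr0 /qreal raddf0.
Qed.

Definition vec_of (M : 'M[C]_2) : 'rV[R]_3 := \row_i nth 0
  [:: - complex.Im (M 0 1); - complex.Re (M 0 1); - complex.Im (M 0 0)] i.

Definition imaginary (M : 'M[C]_2) :=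
  [/\ complex.Re (M 0 0) = 0, M 1 1 = - M 0 0 & M 1 0 = - (M 0 1)^*%C].

Lemma vec_ofK M : imaginary M -> qim (vec_of M) = M.
Proof.
move=> [h0 h1 h2]; rewrite [RHS]mx2E h1 h2 qimE !mxE /=.
case: (M 0 0) h0 => p p' /= ->; case: (M 0 1) => q q'.
by congr mx2; apply/eqP; rewrite eq_complex /=; apply/andP; split; apply/eqP; ring.
Qed.

Lemma imaginaryD M N : imaginary M -> imaginary N -> imaginary (M + N).
Proof.
move=> [h0 h1 h2] [k0 k1 k2]; split; rewrite !mxE.
- by rewrite raddfD /= h0 k0 addr0.
- by rewrite h1 k1 opprD.
- by rewrite h2 k2 conjcD opprD.
Qed.

Lemma imaginaryZ r M : imaginary M -> imaginary (r%:C *: M).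
Proof.
move=> [h0 h1 h2]; split; rewrite !mxE.
- by case: (M 0 0) h0 => ? ? /= ->; ring.
- by rewrite h1 mulrN.
- by rewrite h2 mulrN !conjcE.
Qed.

End Quaternions.

Section Frames.
Variable R : realType.
Local Notation C := R[i].
Implicit Types (l alpha u d : C) (t : R).

Lemma mul_unit_conj l : `|l| = 1 -> l * l^*%C = 1.
Proof. by move=> h; rewrite -sqr_normc h expr1n. Qed.

Lemma unit_conj l : `|l| = 1 -> l^*%C = l^-1.
Proof.
move=> h; apply: (@mulfI _ l); first by rewrite -normr_eq0 h oner_eq0.
by rewrite mul_unit_conj// divff// -normr_eq0 h oner_eq0.
Qed.

Lemma SU2_form (M : 'M[C]_2) : M \is unitarymx -> \det M = 1 ->
  [/\ M 1 1 = (M 0 0)^*%C, M 1 0 = - (M 0 1)^*%C &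
      M 0 0 * (M 0 0)^*%C + M 0 1 * (M 0 1)^*%C = 1].
Proof.
move=> hU hd; have := invmx_unitary hU.
rewrite invmx2 hd ?oner_eq0// invr1 scale1r [RHS]mx2E !mxE => /mx2_inj[h0 h1 h2 _].
have k0 : M 1 1 = (M 0 0)^*%C := h0.
have k1 : M 1 0 = - (M 0 1)^*%C by rewrite -[LHS]opprK h2.
by split=> //; rewrite -hd det_mx2E k0 k1; ring.
Qed.

Variable gamma : C -> 'M[C]_2.
Hypothesis hgamma : loopSU2 gamma.

Lemma is_mderive_dframe t :
  is_mderive (fun s => gamma (expi s)) t (dframe gamma t).
Proof.
by move=> i j; rewrite mxE; apply: smooth_is_cderive; case: hgamma.
Qed.

Lemma loop_unitmx t : gamma (expi t) \in unitmx.
Proof.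
have [_ /(_ _ (norm_expi t))[_ h] _] := hgamma.
by rewrite unitmxE h unitr1.
Qed.

Lemma loop_form t : exists p q p' q' : C,
  [/\ gamma (expi t) = mx2 p q (- q^*%C) p^*%C, dframe gamma t = mx2 p' q' (- q'^*%C) p'^*%C,
      p * p^*%C + q * q^*%C = 1 & p' * p^*%C + p * p'^*%C + (q' * q^*%C + q * q'^*%C) = 0].
Proof.
pose G s := gamma (expi s); pose G' := dframe gamma t.
have form s : [/\ G s 1 1 = (G s 0 0)^*%C, G s 1 0 = - (G s 0 1)^*%C &
      G s 0 0 * (G s 0 0)^*%C + G s 0 1 * (G s 0 1)^*%C = 1].
  have [_ /(_ _ (norm_expi s))[hu hd] _] := hgamma; exact: SU2_form.
have dG i j : is_cderive (fun s => G s i j) t (G' i j) := is_mderive_dframe t i j.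
exists (G t 0 0), (G t 0 1), (G' 0 0), (G' 0 1).
have [h0 h1 h2] := form t; split => //.
- by rewrite [LHS]mx2E -h0 -h1.
- rewrite [LHS]mx2E; congr mx2.
    apply: (is_cderive_unique (dG 1 0)).
    rewrite (_ : (fun s => _) = fun s => -1 * (G s 0 1)^*%C).
      by have := is_cderiveZ (-1) (is_cderive_conj (dG 0 1)); rewrite mulN1r.
    by apply/funext => s; case: (form s) => _ -> _; rewrite mulN1r.
  apply: (is_cderive_unique (dG 1 1)).
  rewrite (_ : (fun s => _) = fun s => (G s 0 0)^*%C); first exact: is_cderive_conj.
  by apply/funext => s; case: (form s).
- have := is_cderiveD (is_cderiveM (dG 0 0) (is_cderive_conj (dG 0 0)))
    (is_cderiveM (dG 0 1) (is_cderive_conj (dG 0 1))).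
  move=> /is_cderive_unique; apply.
  rewrite (_ : (fun s => _) = fun=> 1); first exact: is_cderive_cst.
  by apply/funext => s; case: (form s).
Qed.

Lemma invmx_loop (p q : C) : p * p^*%C + q * q^*%C = 1 ->
  invmx (mx2 p q (- q^*%C) p^*%C) = mx2 p^*%C (- q) (q^*%C) p.
Proof.
move=> h; have hd : \det (mx2 p q (- q^*%C) p^*%C) = 1 by rewrite det_mx2 -h; ring.
by rewrite invmx2 hd ?oner_eq0// invr1 scale1r !mxE /= opprK.
Qed.

Lemma imaginary_logderiv t :
  imaginary (invmx (gamma (expi t)) *m dframe gamma t).
Proof.
have [p [q [p' [q' [-> -> h h']]]]] := loop_form t.
rewrite invmx_loop// mul_mx2; split; rewrite !mxE /=.
- move: h'; case: p q p' q' {h} => [? ?] [? ?] [? ?] [? ?].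
  by move/(congr1 (@complex.Re R)) => /= h; lra.
- by apply/eqP; rewrite -addr_eq0 -h'; apply/eqP; ring.
- by rewrite !conjcE; ring.
Qed.

Lemma imaginary_normal t :
  imaginary ('i%C *: (invmx (gamma (expi t)) *m sigma3 R *m gamma (expi t))).
Proof.
have [p [q [p' [q' [-> _ h _]]]]] := loop_form t.
rewrite invmx_loop// /sigma3 !mx2E_rules; split; rewrite !mxE /=.
- by case: p q {h} => [? ?] [? ?] /=; ring.
- by ring.
- by case: p q {h} => [? ?] [? ?] /=; congr (_ +i* _); ring.
Qed.

End Frames.

(** * The normalising factor of an edge matrix *)

Section Kappa.
Variable R : realType.
Local Notation C := R[i].
Variables (H : R) (alpha : C).
Implicit Types (l : C) (t : R).

(* At [l = expi t], [kappa2 = |1 - spec|^2]. *)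
Definition spec l : C := l ^+ 2 * H%:C * alpha^*%C.

Lemma spec_conj l : `|l| = 1 -> (spec l)^*%C = l ^- 2 * H%:C * alpha.
Proof. by move=> h; rewrite /spec !conjcE (unit_conj h) exprVn. Qed.

Lemma kappa2E l : `|l| = 1 ->
  kappa2 H alpha l = (1 - spec l) * (1 - spec l)^*%C.
Proof. by move=> h; rewrite conjcD conjcN conjc_1 spec_conj// /kappa2 mulrC. Qed.

Lemma kappa2_ge0 l : `|l| = 1 -> 0 <= kappa2 H alpha l.
Proof. by move=> h; rewrite kappa2E// mulcJ_ge0. Qed.

Lemma kappa_sqr l : kappa H alpha l ^+ 2 = kappa2 H alpha l.
Proof. by rewrite /kappa sqrtCK. Qed.

Lemma kappa2_real l : `|l| = 1 ->
  kappa2 H alpha l = (complex.Re (kappa2 H alpha l))%:C.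
Proof. by move=> h; rewrite RRe_real// ger0_real// kappa2_ge0. Qed.

Hypothesis halpha : `|sqrtC (H%:C * alpha)| != 1.

Lemma spec_neq1 l : `|l| = 1 -> 1 - spec l != 0.
Proof.
move=> h; rewrite subr_eq0; apply: contraNneq halpha => h1.
have : `|spec l| = 1 by rewrite -h1 normr1.
rewrite /spec expr2 !normrM h !mul1r normcJ -normrM => h2.
by rewrite -(@pexpr_eq1 _ _ 2)// -normrX sqrtCK h2.
Qed.

Lemma kappa2_gt0 l : `|l| = 1 -> 0 < kappa2 H alpha l.
Proof.
move=> h; rewrite lt_neqAle kappa2_ge0// andbT eq_sym kappa2E// mulf_neq0//.
  exact: spec_neq1.
by rewrite conjc_eq0 spec_neq1.
Qed.

Lemma kappa2_neq0 l : `|l| = 1 -> kappa2 H alpha l != 0.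
Proof. by move=> h; rewrite gt_eqF// kappa2_gt0. Qed.

Lemma kappa_neq0 l : `|l| = 1 -> kappa H alpha l != 0.
Proof. by move=> h; have := kappa2_neq0 h; rewrite -kappa_sqr sqrf_eq0. Qed.

(* The logarithmic derivative of [kappa] in [t], divided by [H]. *)
Definition rho t : R := 2 * complex.Im (spec (expi t)) /
  (H * complex.Re (kappa2 H alpha (expi t))).

Lemma is_cderive_spec t :
  is_cderive (fun s => spec (expi s)) t (2 * 'i%C * spec (expi t)).
Proof.
have h := is_cderive_expi t.
rewrite (_ : (fun s => _) = fun s => H%:C * alpha^*%C * (expi s * expi s)).
  rewrite (_ : 2 * _ * _ = H%:C * alpha^*%C *
    ('i%C * expi t * expi t + expi t * ('i%C * expi t))).
    exact/is_cderiveZ/is_cderiveM.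
  by rewrite /spec; ring.
by apply/funext => s; rewrite /spec; ring.
Qed.

Lemma rhoE t : H != 0 -> H%:C * (rho t)%:C * kappa2 H alpha (expi t) =
  'i%C * ((spec (expi t))^*%C - spec (expi t)).
Proof.
move=> hH; set z := spec (expi t).
have -> : 'i%C * (z^*%C - z) = (2 * complex.Im z)%:C.
  by case: z => a b; congr (_ +i* _) => /=; ring.
have h := norm_expi t; have h2 := kappa2_neq0 h.
rewrite kappa2_real// -!rmorphM; congr (_%:C); rewrite /rho -/z; field.
rewrite hH andbT; apply: contraNneq h2 => h2.
by rewrite kappa2_real// (h2 : complex.Re _ = 0).
Qed.

Lemma is_cderive_kappa t : H != 0 ->
  is_cderive (fun s => kappa H alpha (expi s)) t
    (H%:C * (rho t)%:C * kappa H alpha (expi t)).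
Proof.
move=> hH; pose r s := complex.Re (kappa2 H alpha (expi s)).
have kE s : kappa H alpha (expi s) = (Num.sqrt (r s))%:C.
  have h0 : 0 <= r s by rewrite -ler0c -kappa2_real ?kappa2_ge0 ?norm_expi.
  rewrite /kappa kappa2_real ?norm_expi// -/(r s) -[in LHS](sqr_sqrtr h0) rmorphXn /=.
  by rewrite sqrCK// ler0c sqrtr_ge0.
have rgt0 : 0 < r t by rewrite -ltcR -kappa2_real ?kappa2_gt0 ?norm_expi.
have hr : is_derive t 1 r (2 * (H * rho t * r t)).
  have h1 := is_cderiveD (is_cderive_cst 1 t) (is_cderiveZ (-1) (is_cderive_spec t)).
  have [+ _] := is_cderiveM h1 (is_cderive_conj h1).
  rewrite (_ : (fun s => _) = r); last first.
    by apply/funext => s; rewrite mulN1r /r kappa2E ?norm_expi.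
  rewrite (_ : complex.Re _ = 2 * (H * rho t * r t))//.
  apply: (@complexI R); rewrite (realcM 2) (realcM (H * _)) (realcM H) realc_nat.
  rewrite /r -kappa2_real ?norm_expi// rhoE//.
  case: (spec (expi t)) => a b; apply/eqP; rewrite eq_complex /=.
  by apply/andP; split; apply/eqP; ring.
rewrite (_ : (fun s => _) = fun s => (Num.sqrt (r s))%:C); last first.
  by apply/funext => s; rewrite kE.
rewrite kE -!realcM; apply: is_cderive_real.
have h2 := is_derive1_comp (is_derive1_sqrt rgt0) hr.
apply: is_derive_eq h2 _.
have s0 : Num.sqrt (r t) != 0 by rewrite sqrtr_eq0 -ltNge.
by move: s0 (sqr_sqrtr (ltW rgt0)); move: (Num.sqrt (r t)) => q q0 <-; field.
Qed.

End Kappa.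

(** * The surfaces along an edge *)

Lemma invmx_gauge (K : fieldType) n (F G U : 'M[K]_n) (k : K) :
  k != 0 -> G \in unitmx -> U \in unitmx -> F = k^-1 *: (U *m G) ->
  F \in unitmx /\ invmx F = k *: (invmx G *m invmx U).
Proof.
move=> k0 uG uU hF; have VF : k *: (invmx G *m invmx U) *m F = 1%:M.
  rewrite hF -scalemxAl -scalemxAr scalerA divff// scale1r.
  by rewrite mulmxA mulmxKV// mulVmx.
have uF : F \in unitmx by have [_] := mulmx1_unit VF.
by split=> //; rewrite -[LHS]mul1mx -VF mulmxK.
Qed.

Lemma log_deriv_gauge (K : fieldType) n (F F' G G' U U' S : 'M[K]_n) (k h c r eps del : K) :
  k != 0 -> h != 0 -> G \in unitmx -> U \in unitmx ->
  F = k^-1 *: (U *m G) -> (h * r * k) *: F + k *: F' = U' *m G + U *m G' ->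
  - h^-1 *: (invmx F *m F' + (eps * c) *: (invmx F *m S *m F))
    - - h^-1 *: (invmx G *m G' + (del * c) *: (invmx G *m S *m G)) =
  r%:M - h^-1 *: (invmx G *m (invmx U *m
    (U' + c *: (eps *: (S *m U) - del *: (U *m S)))) *m G).
Proof.
move=> k0 h0 uG uU hF dF.
have [uF iF] := invmx_gauge k0 uG uU hF.
have logF : invmx F *m F' = invmx G *m (invmx U *m U') *m G
    + invmx G *m G' - (h * r)%:M.
  have -> : F' = k^-1 *: (U' *m G + U *m G') - (h * r) *: F.
    rewrite -dF scalerDr !scalerA mulVf// scale1r.
    by rewrite mulrCA mulVf// mulr1 [RHS]addrAC subrr add0r.
  rewrite mulmxBr -[in X in _ - X]scalemxAr mulVmx// scalemx1; congr (_ - _).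
  rewrite iF -scalemxAl -scalemxAr scalerA divff// scale1r mulmxDr !mulmxA.
  by rewrite mulmxKV.
have conjF : invmx F *m S *m F = invmx G *m (invmx U *m (S *m U)) *m G.
  by rewrite iF hF -!scalemxAl -scalemxAr scalerA divff// scale1r !mulmxA.
have conjG : invmx G *m S *m G = invmx G *m (invmx U *m (U *m S)) *m G.
  by rewrite mulKmx.
rewrite logF conjF conjG.
rewrite !(mulmxDl, mulmxDr, scalerDr, mulmxN, mulNmx, scalerN) -!(scalemxAr, scalemxAl).
move: (invmx G *m G') => X.
move: (invmx G *m (invmx U *m (S *m U)) *m G) => A.
move: (invmx G *m (invmx U *m (U *m S)) *m G) => B.
move: (invmx G *m (invmx U *m U') *m G) => Z.
by apply/matrixP => i j; rewrite !mxE; case: (i == j); rewrite ?mulr1n ?mulr0n; field.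
Qed.

Section SymSurfaces.
Variable R : realType.
Local Notation C := R[i].
Variable H : R.
Implicit Types (g : C -> 'M[C]_2) (t : R).

(* [eps = -1] gives the surface, [eps = 1] its dual. *)
Definition sym_family (eps : C) g t : 'M[C]_2 :=
  - (H%:C)^-1 *: (invmx (g (expi t)) *m dframe g t
    + (eps * ('i%C / 2)) *: (invmx (g (expi t)) *m sigma3 R *m g (expi t))).

Lemma sym_surfaceE g t : sym_surface H g t = sym_family (-1) g t.
Proof. by rewrite /sym_surface /sym_family mulN1r (scaleNr ('i%C / 2)). Qed.

Lemma sym_surface_dualE g t : sym_surface_dual H g t = sym_family 1 g t.
Proof. by rewrite /sym_surface_dual /sym_family mul1r. Qed.

Lemma imaginary_sym_family (eps : R) g t : loopSU2 g ->
  imaginary (sym_family eps%:C g t).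
Proof.
move=> hg; rewrite /sym_family -realcV -realcN; apply: imaginaryZ; apply: imaginaryD.
  exact: imaginary_logderiv.
have -> : eps%:C * ('i%C / 2) = (eps / 2)%:C * 'i%C.
  by rewrite realcM realcV realc_nat; ring.
by rewrite -scalerA; apply: imaginaryZ; exact: imaginary_normal.
Qed.

Lemma sym_family_diff g t : loopSU2 g -> H != 0 ->
  \det (sym_family (-1) g t - sym_family 1 g t) = (1 / H ^+ 2)%:C.
Proof.
move=> hg hH; rewrite /sym_family -scalerBr opprD addrACA subrr add0r -scalerBl.
have -> : (-1 * ('i%C / 2) - 1 * ('i%C / 2)) = - 'i%C :> C by field.
rewrite !detZ !det_mulmx.
have -> : \det (sigma3 R) = -1 by rewrite /sigma3 det_mx2; ring.
have [_ /(_ _ (norm_expi t))[_ hd] _] := hg.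
rewrite det_inv hd invr1 mul1r mulr1.
have i2 : 'i%C ^+ 2 = -1 :> C := sqr_i R.
rewrite realcV realcX.
have hH' : H%:C != 0 by rewrite (inj_eq (@complexI R)).
by rewrite !sqrrN i2; field.
Qed.

End SymSurfaces.

Definition edge_rel (R : realType) (H : R) (alpha u d : R[i]) (Pi Pj : R[i] -> 'M[R[i]]_2) :=
  forall l, `|l| = 1 ->
    \det (frame_mx H alpha u d l) = kappa2 H alpha l /\
    Pj l = (kappa H alpha l)^-1 *: (frame_mx H alpha u d l *m Pi l).

Section Edge.
Variable R : realType.
Local Notation C := R[i].
Variables (H : R) (alpha u d : C) (Pi Pj : C -> 'M[C]_2).
Hypotheses (hH : H != 0) (halpha : `|sqrtC (H%:C * alpha)| != 1) (hu : u != 0).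
Hypotheses (hPi : loopSU2 Pi) (hPj : loopSU2 Pj).
Hypothesis hedge : edge_rel H alpha u d Pi Pj.
Implicit Types (t : R).

Local Notation U t := (frame_mx H alpha u d (expi t)).

Definition frame_deriv t : 'M[C]_2 := let l := expi t in
  mx2 0 (- 'i%C * (l^-1 * H%:C * u + l * alpha^*%C / u^*%C))
    (- 'i%C * (l^-1 * alpha / u + l * H%:C * u^*%C)) 0.

Lemma is_mderive_frame t : is_mderive (fun s => U s) t (frame_deriv t).
Proof.
have dl := is_cderive_expi t.
have dV : is_cderive (fun s => (expi s)^-1) t (- 'i%C * (expi t)^-1).
  rewrite (_ : (fun s => _) = fun s => (expi s)^*%C).
    by rewrite -unit_conj ?norm_expi// -conjci -conjcM; exact: is_cderive_conj.
  by apply/funext => s; rewrite unit_conj ?norm_expi.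
have lin (p q : C) : is_cderive (fun s => p * (expi s)^-1 + q * expi s) t
    (p * (- 'i%C * (expi t)^-1) + q * ('i%C * expi t)).
  by apply: is_cderiveD; apply: is_cderiveZ.
move=> i j; rewrite (_ : (fun s => _) = fun s =>
    if i == 0 then if j == 0 then d else
      (H%:C * u) * (expi s)^-1 + (- (alpha^*%C / u^*%C)) * expi s
    else if j == 0 then
      (alpha / u) * (expi s)^-1 + (- (H%:C * u^*%C)) * expi s
    else d^*%C); last first.
  by apply/funext => s; rewrite mxE; do 2!case: ifP => _ //; ring.
rewrite mxE; case: ifP => _; case: ifP => _; first exact: is_cderive_cst.
- by have := lin (H%:C * u) (- (alpha^*%C / u^*%C)); congr is_cderive; ring.
- by have := lin (alpha / u) (- (H%:C * u^*%C)); congr is_cderive; ring.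
- exact: is_cderive_cst.
Qed.

Lemma frame_unitmx l : `|l| = 1 -> frame_mx H alpha u d l \in unitmx.
Proof.
by move=> h; rewrite unitmxE unitfE; have [-> _] := hedge h; exact: kappa2_neq0.
Qed.

Lemma edge_diff (eps del : C) t :
  sym_family H eps Pj t - sym_family H del Pi t =
  (rho H alpha t)%:C%:M - H%:C^-1 *: (invmx (Pi (expi t)) *m (invmx (U t) *m
    (frame_deriv t + ('i%C / 2) *: (eps *: (sigma3 R *m U t)
      - del *: (U t *m sigma3 R)))) *m Pi (expi t)).
Proof.
have hl := norm_expi t; have [_ hP] := hedge hl; set G := Pi (expi t).
have uG : G \in unitmx := loop_unitmx hPi t.
have uF := loop_unitmx hPj t; have uU := frame_unitmx hl.
have k0 := kappa_neq0 halpha hl; set k := kappa H alpha (expi t) in k0 hP.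
have hH' : H%:C != 0 by rewrite (inj_eq (@complexI R)).
set F := Pj (expi t) in hP uF *; set r := (rho H alpha t)%:C.
have dF : (H%:C * r * k) *: F + k *: dframe Pj t =
    frame_deriv t *m G + U t *m dframe Pi t.
  have h1 := is_mderiveZ (is_cderive_kappa halpha t hH) (is_mderive_dframe hPj t).
  have h2 := is_mderiveM (is_mderive_frame t) (is_mderive_dframe hPi t).
  apply: is_mderive_unique h1 _.
  rewrite (_ : (fun s => _ *: _) = fun s => U s *m Pi (expi s))//.
  apply/funext => s; have [_ ->] := hedge (norm_expi s).
  by rewrite scalerA divff ?scale1r// kappa_neq0// norm_expi.
exact: (log_deriv_gauge _ _ _ _ k0 hH' uG uU hP dF).
Qed.

End Edge.

(** * Compatibility around a quadrilateral *)

Section LaurentCoefficients.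
Variable R : realType.
Local Notation C := R[i].
Implicit Types (a b c p q r s d e l : C).

Let sqr_i' : 'i%C ^+ 2 = -1 :> C := sqr_i R.

Lemma norm_i : `|'i%C : C| = 1.
Proof. by apply/eqP; rewrite -(@pexpr_eq1 _ _ 2)// -normrX sqr_i' normrN normr1. Qed.

Lemma i_neq0 : 'i%C != 0 :> C.
Proof. by rewrite -normr_eq0 norm_i oner_eq0. Qed.

Lemma invi : 'i%C^-1 = - 'i%C :> C.
Proof. by apply: (mulfI i_neq0); rewrite divff ?i_neq0// mulrN -expr2 sqr_i' opprK. Qed.

Lemma laurent_odd b c : (forall l, `|l| = 1 -> l^-1 * b + l * c = 0) -> c = 0.
Proof.
move=> h; have := h 1 (normr1 _); rewrite invr1 !mul1r => h1.
have := h _ norm_i; rewrite invi => h2.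
have : 2 * 'i%C * c = 0.
  rewrite (_ : 2 * _ * c = (- 'i%C * b + 'i%C * c) + 'i%C * (b + c)); last by ring.
  by rewrite h1 h2 mulr0 addr0.
by move/eqP; rewrite !mulf_eq0 pnatr_eq0 (negPf i_neq0) => /eqP.
Qed.

Lemma laurent_even a b c :
  (forall l, `|l| = 1 -> a + l^-2 * b + l ^+ 2 * c = 0) -> c = 0.
Proof.
move=> h; have nsqrt : `|sqrtC 'i%C : C| = 1.
  by apply/eqP; rewrite -(@pexpr_eq1 _ _ 2)// -normrX sqrtCK norm_i.
have := h 1 (normr1 _); rewrite expr1n invr1 !mul1r => h1.
have := h _ norm_i; rewrite sqr_i' invrN1 !mulN1r => h2.
have := h _ nsqrt; rewrite sqrtCK invi => h3.
have a0 : a = 0.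
  have : 2 * a = 0.
    rewrite (_ : 2 * a = (a + b + c) + (a - b - c)); last by ring.
    by rewrite h1 h2 addr0.
  by move/eqP; rewrite mulf_eq0 pnatr_eq0 => /eqP.
have : 2 * 'i%C * c = 0.
  rewrite (_ : 2 * _ * c = (a + - 'i%C * b + 'i%C * c) + 'i%C * (a + b + c)).
    by rewrite h1 h3 mulr0 addr0.
  by rewrite a0; ring.
by move/eqP; rewrite !mulf_eq0 pnatr_eq0 (negPf i_neq0) => /eqP.
Qed.

(* Both sides of the hypothesis are Laurent polynomials in [l]; the conclusion compares their
   leading coefficients. *)
Lemma quad_lambda_part d p q r s e d' p' q' r' s' e' c f g v w b c' f' g' v' w' b' :
  (forall l, `|l| = 1 ->
    mx2 d' (l^-1 * p' - l * q') (l^-1 * r' - l * s') e' *m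
      mx2 d (l^-1 * p - l * q) (l^-1 * r - l * s) e =
    mx2 c' (l^-1 * f' - l * g') (l^-1 * v' - l * w') b' *m
      mx2 c (l^-1 * f - l * g) (l^-1 * v - l * w) b) ->
  forall l, mx2 d' (- (l * q')) (- (l * s')) 0 *m mx2 0 (- (l * q)) (- (l * s)) e =
    mx2 c' (- (l * g')) (- (l * w')) 0 *m mx2 0 (- (l * g)) (- (l * w)) b.
Proof.
move=> h l.
have h00 : q' * s = g' * w.
  apply/eqP; rewrite -subr_eq0; apply/eqP; apply: (@laurent_even
    (d' * d - p' * s - q' * r - (c' * c - f' * w - g' * v)) (p' * r - f' * v)).
  move=> m hm; have m0 : m != 0 by rewrite -normr_eq0 hm oner_eq0.
  have := h m hm; rewrite !mul_mx2 => /mx2_inj[e0 _ _ _].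
  by move/eqP: e0; rewrite -subr_eq0 => /eqP <-; field.
have h11 : s' * q = w' * g.
  apply/eqP; rewrite -subr_eq0; apply/eqP; apply: (@laurent_even
    (e' * e - r' * q - s' * p - (b' * b - v' * g - w' * f)) (r' * p - v' * f)).
  move=> m hm; have m0 : m != 0 by rewrite -normr_eq0 hm oner_eq0.
  have := h m hm; rewrite !mul_mx2 => /mx2_inj[_ _ _ e0].
  by move/eqP: e0; rewrite -subr_eq0 => /eqP <-; field.
have h01 : - (d' * q + q' * e) = - (c' * g + g' * b).
  apply/eqP; rewrite -subr_eq0; apply/eqP; apply: (@laurent_odd
    (d' * p + p' * e - (c' * f + f' * b))).
  move=> m hm; have m0 : m != 0 by rewrite -normr_eq0 hm oner_eq0.
  have := h m hm; rewrite !mul_mx2 => /mx2_inj[_ e0 _ _].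
  by move/eqP: e0; rewrite -subr_eq0 => /eqP <-; field.
rewrite !mul_mx2; congr mx2.
- by transitivity (l ^+ 2 * (q' * s)); [ring | rewrite h00; ring].
- by transitivity (l * (- (d' * q + q' * e))); [ring | rewrite h01; ring].
- by ring.
- by transitivity (l ^+ 2 * (s' * q)); [ring | rewrite h11; ring].
Qed.

End LaurentCoefficients.

Section EdgeMaps.
Variable R : realType.
Local Notation C := R[i].
Implicit Types (H : R) (alpha u d l : C) (Pi Pj : C -> 'M[C]_2).

(* Let D = diag(l^(1/2), l^(-1/2)).  Replacing the frame by D^-1 Phi at the vertices
   where [f] is used and by D Phi at those where [f*] is used turns both surfaces
   into -1/H times the logarithmic derivative of the frame, and makes the edge
   matrices of the form l^-1 X + l Y.  Conjugating l Y back by the gauge gives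
   [lambda_part_dual] on an edge from an [f*]-vertex to an [f]-vertex, and
   [lambda_part_primal] on an edge from an [f]-vertex to an [f*]-vertex. *)
Definition lambda_part_dual H alpha u d l :=
  mx2 0 (- (l * (alpha^*%C / u^*%C))) (- (l * (H%:C * u^*%C))) d^*%C.
Definition lambda_part_primal H alpha u d l :=
  mx2 d (- (l * (alpha^*%C / u^*%C))) (- (l * (H%:C * u^*%C))) 0.

Definition transfer (U B G : 'M[C]_2) := invmx G *m (invmx U *m B) *m G.

Variables (H : R) (alpha u d : C) (Pi Pj : C -> 'M[C]_2).
Hypotheses (hH : H != 0) (halpha : `|sqrtC (H%:C * alpha)| != 1) (hu : u != 0).
Hypotheses (hPi : loopSU2 Pi) (hPj : loopSU2 Pj).
Hypothesis hedge : edge_rel H alpha u d Pi Pj.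
Implicit Types (t : R).

Local Notation U t := (frame_mx H alpha u d (expi t)).
Local Notation G t := (Pi (expi t)).

Let hH' : H%:C != 0. Proof. by rewrite (inj_eq (@complexI R)). Qed.

Lemma transfer_affine (X V B g : 'M[C]_2) (r h : C) : g \in unitmx -> V \in unitmx ->
  X = r%:M - h^-1 *: (invmx g *m (invmx V *m ((- 'i%C) *: (V - 2 *: B))) *m g) ->
  X - r%:M = ('i%C / h) *: (1%:M - 2 *: transfer V B g).
Proof.
move=> ug uV ->; rewrite addrAC subrr add0r -scalemxAr mulmxBr mulVmx// -!scalemxAr.
rewrite -scalemxAl mulmxBr mulmx1 mulmxBl mulVmx// -scalemxAr -scalemxAl.
by rewrite -scaleNr scalerA /transfer; congr (_ *: _); ring.
Qed.

Lemma edge_from_dual t :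
  sym_family H (-1) Pj t - sym_family H 1 Pi t - (rho H alpha t)%:C%:M =
  ('i%C / H%:C) *: (1%:M
    - 2 *: transfer (U t) (lambda_part_dual H alpha u d (expi t)) (G t)).
Proof.
apply: transfer_affine; [exact: loop_unitmx| |].
  exact: (frame_unitmx halpha hedge (norm_expi t)).
have E : frame_deriv H alpha u t + ('i%C / 2) *:
    ((-1) *: (sigma3 R *m U t) - 1 *: (U t *m sigma3 R)) =
    (- 'i%C) *: (U t - 2 *: lambda_part_dual H alpha u d (expi t)).
  rewrite /frame_deriv /sigma3 /frame_mx /lambda_part_dual !mx2E_rules.
  by congr mx2; field; rewrite ?conjc_eq0 ?hu ?expi_neq0.
by rewrite (edge_diff hH halpha hPi hPj hedge) E.
Qed.

Lemma edge_from_primal t :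
  sym_family H 1 Pj t - sym_family H (-1) Pi t - (rho H alpha t)%:C%:M =
  ('i%C / H%:C) *: (1%:M
    - 2 *: transfer (U t) (lambda_part_primal H alpha u d (expi t)) (G t)).
Proof.
apply: transfer_affine; [exact: loop_unitmx| |].
  exact: (frame_unitmx halpha hedge (norm_expi t)).
have E : frame_deriv H alpha u t + ('i%C / 2) *:
    (1 *: (sigma3 R *m U t) - (-1) *: (U t *m sigma3 R)) =
    (- 'i%C) *: (U t - 2 *: lambda_part_primal H alpha u d (expi t)).
  rewrite /frame_deriv /sigma3 /frame_mx /lambda_part_primal !mx2E_rules.
  by congr mx2; field; rewrite ?conjc_eq0 ?hu ?expi_neq0.
by rewrite (edge_diff hH halpha hPi hPj hedge) E.
Qed.

(* The right-hand side determines the argument of [alpha], hence a quadrilateral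
   with vanishing hyperedge would have two labels of equal argument. *)
Lemma det_edge_from_dual t :
  \det (1%:M + ('i%C * H%:C) *: (sym_family H (-1) Pj t - sym_family H 1 Pi t
     - (rho H alpha t)%:C%:M)) =
  - 4 * spec H alpha (expi t) / kappa2 H alpha (expi t).
Proof.
rewrite edge_from_dual scalerA.
have ii : 'i%C * 'i%C = -1 :> C by rewrite -expr2 sqr_i.
have -> : 'i%C * H%:C * ('i%C / H%:C) = -1 by rewrite mulrCA mulfK// ii.
rewrite scaleN1r opprB addrC subrK detZ /transfer !det_mulmx !det_inv.
have [-> _] := hedge (norm_expi t).
have ug : \det (G t) != 0 by rewrite -unitfE -unitmxE loop_unitmx.
have k0 := kappa2_neq0 halpha (norm_expi t).
rewrite /lambda_part_dual det_mx2 /spec; field.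
by rewrite ug k0 conjc_eq0 hu.
Qed.

Lemma frame_parallel t : alpha^*%C = alpha ->
  (expi t)^-1 = expi t -> rho H alpha t = 0 ->
  let df := sym_family H (-1) Pj t - sym_family H (-1) Pi t in
  sym_family H 1 Pj t - sym_family H 1 Pi t = (alpha / (H%:C * (u * u^*%C))) *: df /\
  \det df = 4 * (u * u^*%C) / kappa2 H alpha (expi t).
Proof.
move=> hr ht r0 df; have hl := norm_expi t.
have l2 : expi t * expi t = 1 by rewrite -{1}ht mulVf// -normr_eq0 hl oner_eq0.
have uc : u^*%C != 0 by rewrite conjc_eq0.
pose P := mx2 0 u u^*%C 0.
have z0 : (0 : R)%:C%:M = 0 :> 'M[C]_2 by exact: raddf0.
have ug : \det (G t) != 0 by rewrite -unitfE -unitmxE loop_unitmx.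
have k0 := kappa2_neq0 halpha hl.
have Ef : frame_deriv H alpha u t + ('i%C / 2) *:
    ((-1) *: (sigma3 R *m U t) - (-1) *: (U t *m sigma3 R)) =
    (- (2 * 'i%C * H%:C * expi t)) *: P.
  rewrite /frame_deriv /sigma3 /frame_mx /P !mx2E_rules ht hr.
  by congr mx2; field; rewrite ?uc ?hu.
have Efs : frame_deriv H alpha u t + ('i%C / 2) *:
    (1 *: (sigma3 R *m U t) - 1 *: (U t *m sigma3 R)) =
    (- (2 * 'i%C * expi t * (alpha / (u * u^*%C)))) *: P.
  rewrite /frame_deriv /sigma3 /frame_mx /P !mx2E_rules ht hr.
  by congr mx2; field; rewrite ?uc ?hu.
have dfE : df = (2 * 'i%C * expi t) *: (invmx (G t) *m (invmx (U t) *m P) *m G t).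
  rewrite /df (edge_diff hH halpha hPi hPj hedge) Ef r0 z0 sub0r -scaleNr.
  by rewrite -!(scalemxAr, scalemxAl) scalerA; congr (_ *: _); field; exact: hH'.
split.
  rewrite dfE (edge_diff hH halpha hPi hPj hedge) Efs r0 z0 sub0r -scaleNr.
  rewrite -!(scalemxAr, scalemxAl) !scalerA; congr (_ *: _); field.
  by rewrite uc hu hH'.
rewrite dfE detZ !det_mulmx !det_inv; have [-> _] := hedge hl.
rewrite (_ : \det P = - (u * u^*%C)); last by rewrite det_mx2; ring.
rewrite (_ : (2 * 'i%C * expi t) ^+ 2 = 4 * 'i%C ^+ 2 * (expi t * expi t)); last by ring.
by rewrite sqr_i l2; field; rewrite ug k0.
Qed.

End EdgeMaps.

Lemma transfer_mul (K : realType) (B B' G F U U' : 'M[K[i]]_2) k :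
  k != 0 -> G \in unitmx -> U \in unitmx -> U' \in unitmx -> F = k^-1 *: (U *m G) ->
  U' *m U *m G *m (transfer U' B' F *m transfer U B G) = B' *m B *m G.
Proof.
move=> k0 uG uU uU' hF; have [uF _] := invmx_gauge k0 uG uU hF.
have UG : U *m G = k *: F by rewrite hF scalerA divff// scale1r.
rewrite -(mulmxA U') UG /transfer -scalemxAr -scalemxAl !mulmxA.
rewrite mulmxK// mulmxV// mul1mx 4!scalemxAl scalemxAr -UG !mulmxA.
by rewrite mulmxK// mulmxK.
Qed.

Lemma transfer_quad (K : realType) (G F0 F2 U0 U1 U2 U3 B0 B1 B2 B3 : 'M[K[i]]_2) k k' :
  k != 0 -> k' != 0 -> G \in unitmx -> U0 \in unitmx -> U1 \in unitmx ->
  U2 \in unitmx -> U3 \in unitmx ->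
  F0 = k^-1 *: (U0 *m G) -> F2 = k'^-1 *: (U2 *m G) ->
  U1 *m U0 = U3 *m U2 -> B1 *m B0 = B3 *m B2 ->
  transfer U1 B1 F0 *m transfer U0 B0 G = transfer U3 B3 F2 *m transfer U2 B2 G.
Proof.
move=> k0 k0' uG u0 u1 u2 u3 h0 h2 hU hB.
have uW : U3 *m U2 *m G \in unitmx.
  by rewrite unitmx_mul uG andbT unitmx_mul u3 u2.
have m2 := transfer_mul B2 B3 k0' uG u2 u3 h2.
have := transfer_mul B0 B1 k0 uG u0 u1 h0; rewrite hU hB -m2.
exact: (can_inj (mulKmx uW)).
Qed.

Lemma mul_affine (K : fieldType) n (c : K) (X X' Y Y' T T' S S' : 'M[K]_n) :
  c != 0 -> X' = c *: (1%:M - 2 *: T') -> X = c *: (1%:M - 2 *: T) ->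
  Y' = c *: (1%:M - 2 *: S') -> Y = c *: (1%:M - 2 *: S) ->
  X' + X = Y' + Y -> T' *m T = S' *m S -> X' *m X = Y' *m Y.
Proof.
move=> c0 eX' eX eY' eY hsum hprod.
have expand (V' V : 'M[K]_n) : (c *: (1%:M - 2 *: V')) *m (c *: (1%:M - 2 *: V)) =
    c *: (c *: (1%:M - 2 *: V') + c *: (1%:M - 2 *: V)) - (c * c) *: 1%:M
      + (c * c * 4) *: (V' *m V).
  rewrite -scalemxAl -scalemxAr mulmxBl !mulmxBr !mul1mx !mulmx1 -!(scalemxAl, scalemxAr).
  by move: (V' *m V) => W; apply/matrixP => i j; rewrite !mxE; ring.
by rewrite eX' eX expand -eX -eX' hsum hprod eY' eY expand.
Qed.

Lemma subr_path4 (V : zmodType) (a b c d r s : V) :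
  d - a - s + (a - b - r) = d - c - r + (c - b - s).
Proof.
have path e p q : d - e - p + (e - b - q) = d - b - (p + q).
  by rewrite addrACA -opprD addrA subrK.
by rewrite !path [s + r]addrC.
Qed.

Section Quad.
Variable R : realType.
Local Notation C := R[i].
Variables (H : R) (alpha beta : C) (u0 d0 u1 d1 u2 d2 u3 d3 : C).
Variables P0 P1 P2 P3 : C -> 'M[C]_2.
Hypotheses (hH : H != 0) (halpha : `|sqrtC (H%:C * alpha)| != 1)
  (hbeta : `|sqrtC (H%:C * beta)| != 1).
Hypotheses (hu0 : u0 != 0) (hu1 : u1 != 0) (hu2 : u2 != 0) (hu3 : u3 != 0).
Hypotheses (hP0 : loopSU2 P0) (hP1 : loopSU2 P1) (hP2 : loopSU2 P2) (hP3 : loopSU2 P3).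
Hypotheses (e10 : edge_rel H alpha u0 d0 P1 P0) (e03 : edge_rel H beta u1 d1 P0 P3)
  (e12 : edge_rel H beta u2 d2 P1 P2) (e23 : edge_rel H alpha u3 d3 P2 P3).

Lemma quad_flat l : `|l| = 1 ->
  frame_mx H beta u1 d1 l *m frame_mx H alpha u0 d0 l =
  frame_mx H alpha u3 d3 l *m frame_mx H beta u2 d2 l.
Proof.
move=> hl; have [_ h10] := e10 hl; have [_ h03] := e03 hl.
have [_ h12] := e12 hl; have [_ h23] := e23 hl.
have u1' : P1 l \in unitmx.
  by have [_ /(_ _ hl)[_ h] _] := hP1; rewrite unitmxE h unitr1.
move: h03; rewrite h23 h12 h10 -!scalemxAr !scalerA [X in X *: _ = _]mulrC !mulmxA.
move=> /(scalerI _) h; apply/esym/(can_inj (mulmxK u1')); apply: h.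
by rewrite mulf_neq0// invr_eq0 kappa_neq0.
Qed.

Lemma quad_lambda_flat l :
  lambda_part_primal H beta u1 d1 l *m lambda_part_dual H alpha u0 d0 l =
  lambda_part_primal H alpha u3 d3 l *m lambda_part_dual H beta u2 d2 l.
Proof.
have frameE a u d m : frame_mx H a u d m = mx2 d (m^-1 * (H%:C * u) - m * (a^*%C / u^*%C))
    (m^-1 * (a / u) - m * (H%:C * u^*%C)) d^*%C.
  by rewrite /frame_mx !mulrA.
apply: quad_lambda_part => m hm.
by have := quad_flat hm; rewrite !frameE => h; exact: h.
Qed.

Local Notation ra t := (rho H alpha t)%:C%:M.
Local Notation rb t := (rho H beta t)%:C%:M.
Local Notation f P t := (sym_family H (-1) P t).
Local Notation fs P t := (sym_family H 1 P t).

Lemma quad_transport t :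
  (fs P3 t - f P0 t - rb t) *m (f P0 t - fs P1 t - ra t) =
  (fs P3 t - f P2 t - ra t) *m (f P2 t - fs P1 t - rb t).
Proof.
have hl := norm_expi t.
have uP g : loopSU2 g -> g (expi t) \in unitmx by move=> h; exact: loop_unitmx.
have v0 := frame_unitmx halpha e10 hl; have v1 := frame_unitmx hbeta e03 hl.
have v2 := frame_unitmx hbeta e12 hl; have v3 := frame_unitmx halpha e23 hl.
have q0 := edge_from_dual hH halpha hu0 hP1 hP0 e10 t.
have q1 := edge_from_primal hH hbeta hu1 hP0 hP3 e03 t.
have q2 := edge_from_dual hH hbeta hu2 hP1 hP2 e12 t.
have q3 := edge_from_primal hH halpha hu3 hP2 hP3 e23 t.
apply: (mul_affine _ q1 q0 q3 q2).
- by rewrite mulf_neq0 ?i_neq0// invr_eq0 (inj_eq (@complexI R)).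
- exact: subr_path4.
- exact: (transfer_quad (kappa_neq0 halpha hl) (kappa_neq0 hbeta hl) (uP _ hP1)
    v0 v1 v2 v3 (e10 hl).2 (e12 hl).2 (quad_flat hl) (quad_lambda_flat (expi t))).
Qed.

End Quad.

(** * Quaternionic geometry of a quadrilateral *)

Lemma mx_factor (K : fieldType) n (A B B' : 'M[K]_n) (p q : K) :
  ((q - p)%:M + (B - A)) *m B' = A *m ((q - p)%:M + (B - A)) ->
  ((q - p)%:M + (B - A)) *m ((q + p)%:M + (B' + B)) =
  (B + q%:M) *m (B + q%:M) - (A + p%:M) *m (A + p%:M).
Proof.
move=> h; rewrite mulmxDr [X in _ + X]mulmxDr h mul_mx_scalar.
rewrite !(mulmxDl, mulmxDr) !mulmxN !mulNmx !mul_mx_scalar !mul_scalar_mx.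
move: (A *m B) (A *m A) (B *m B) => AB AA BB.
by apply/matrixP => i j; rewrite !mxE; case: (i == j); rewrite ?mulr1n ?mulr0n; ring.
Qed.

Lemma cross_ratio_of_dual (K : fieldType) n (A B E G : 'M[K]_n) (m1 m2 : K) :
  m2 != 0 -> B \in unitmx -> E \in unitmx -> G \in unitmx -> A + B + E + G = 0 ->
  (A + B) *m (m2 *: invmx B + m1 *: invmx E) = (m2 - m1)%:M ->
  A *m invmx B *m E *m invmx G = (m1 / m2)%:M.
Proof.
move=> m0 uB uE uG hsum h; apply: (can_inj (mulmxK uG)); rewrite mulmxKV//.
apply: (scalerI m0).
have {}h : m2 *: (A *m invmx B *m E + E) + m1 *: (A + B) = (m2 - m1) *: E.
  rewrite -[RHS]mul_scalar_mx -h -[RHS]mulmxA (mulmxDl (m2 *: _)) -!scalemxAl mulVmx// mulmxDr.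
  by rewrite -!scalemxAr mulmx1 mulmxDl mulmxA (mulmxA B) mulmxV// mul1mx.
rewrite mul_scalar_mx scalerA mulrCA divff// mulr1.
rewrite (_ : G = - (A + B + E)); last by apply/eqP; rewrite -addr_eq0 addrC hsum.
move: h; move: (A *m _ *m _) => X; move=> /matrixP h; apply/matrixP => i j.
move: (h i j); rewrite !mxE => e.
rewrite (_ : m2 * X i j = m2 * (X i j + E i j) + m1 * (A i j + B i j)
  - m2 * E i j - m1 * (A i j + B i j)); last by ring.
by rewrite e; ring.
Qed.

Lemma invmxN (K : fieldType) n (A : 'M[K]_n) :
  A \in unitmx -> invmx (- A) = - invmx A.
Proof.
move=> uA; have uN : - A \in unitmx by rewrite -scaleN1r unitmxZ ?unitrN1.
by apply: (can_inj (mulKmx uN)); rewrite mulmxV// mulNmx mulmxN opprK mulmxV.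
Qed.

Lemma mulmx4N (K : fieldType) n (A B E G A' B' E' G' : 'M[K]_n) :
  A' = - A -> B' = - B -> E' = - E -> G' = - G ->
  A' *m B' *m E' *m G' = A *m B *m E *m G.
Proof. by move=> -> -> -> ->; rewrite !(mulNmx, mulmxN) !opprK. Qed.

Lemma subr_chain (V : zmodType) (a b c : V) : b - a + (c - b) = c - a.
Proof. by rewrite addrC addrA subrK. Qed.

Section QuaternionicQuad.
Variable R : realType.
Local Notation C := R[i].
Implicit Types (x y : 'rV[R]_3) (p q : R).

Lemma qimN x : qim (- x) = - qim x.
Proof. by rewrite -sub0r qimB qim0 sub0r. Qed.

Lemma qimD x y : qim (x + y) = qim x + qim y.
Proof. by rewrite -[y in LHS]opprK qimB qimN opprK. Qed.

Lemma quat_transport x y x' y' p q : x' + x = y' + y ->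
  (qim x' - q%:C%:M) *m (qim x - p%:C%:M) = (qim y' - p%:C%:M) *m (qim y - q%:C%:M) ->
  (qreal (q - p) + qim (y - x)) *m qim y' = qim x *m (qreal (q - p) + qim (y - x)).
Proof.
move=> /(canRL (addrK x)) ->; rewrite /qreal realcD realcN !(qimB, qimD).
have traceless (z : 'rV[R]_3) : exists a b c, qim z = mx2 a b c (- a).
  exists (- 'i%C * (z 0 2%:R)%:C); do 2!eexists; rewrite qimE; congr mx2.
  by rewrite mulNr opprK.
have [a0 [a1 [a2 ->]]] := traceless x; have [b0 [b1 [b2 ->]]] := traceless y.
have [c0 [c1 [c2 ->]]] := traceless y'.
move: p%:C q%:C => {}p {}q; rewrite !mx2E_rules => /mx2_inj[h00 h01 h10 h11].
have z (s1 s2 s3 s4 : C) : s1 = s2 -> s3 - s4 = s2 - s1 -> s3 = s4.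
  by move=> ->; rewrite subrr => /subr0_eq.
congr mx2; [apply: z h11 _|apply: z (esym h01) _|apply: z (esym h10) _|apply: z h00 _]; ring.
Qed.

Lemma quat_factor x y y' p q :
  (qreal (q - p) + qim (y - x)) *m qim y' = qim x *m (qreal (q - p) + qim (y - x)) ->
  (qreal (q - p) + qim (y - x)) *m (qreal (q + p) + qim (y' + y)) =
  (qim y + q%:C%:M) *m (qim y + q%:C%:M) - (qim x + p%:C%:M) *m (qim x + p%:C%:M).
Proof.
by rewrite /qreal !realcD realcN !qimB qimD; exact: mx_factor.
Qed.

Lemma qim_comm_scalar x y (c : C) :
  qim x *m qim y = c%:M -> qim y *m qim x = c%:M.
Proof.
rewrite !qimE scalar_mx2 !mul_mx2 => /mx2_inj[h00 h01 h10 h11].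
congr mx2; first by rewrite -h11; ring.
- by apply: oppr_inj; rewrite oppr0 -[RHS]h01; ring.
- by apply: oppr_inj; rewrite oppr0 -[RHS]h10; ring.
- by rewrite -h00; ring.
Qed.

Lemma qim_unitmx x : sqnorm x != 0 -> qim x \in unitmx.
Proof. by move=> h; rewrite unitmxE unitfE det_qim (inj_eq (@complexI R)). Qed.

Lemma invmx_qim x : sqnorm x != 0 -> invmx (qim x) = - (sqnorm x)%:C^-1 *: qim x.
Proof.
move=> h; have ux := qim_unitmx h.
have n0 : (sqnorm x)%:C != 0 by rewrite (inj_eq (@complexI R)).
apply: (can_inj (mulKmx ux)).
by rewrite mulmxV// -scalemxAr qim_sqr scale_scalar_mx mulrNN mulVf.
Qed.

Lemma sqnormZ (k : R) x : sqnorm (k *: x) = k ^+ 2 * sqnorm x.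
Proof.
by rewrite /sqnorm mulr_sumr; apply: eq_bigr => i _; rewrite mxE exprMn.
Qed.

Lemma sqnormN x : sqnorm (- x) = sqnorm x.
Proof. by rewrite -scaleN1r sqnormZ sqrrN expr1n mul1r. Qed.

Lemma dual_quad_cross_ratio (g0 g1 g2 g3 h1 h2 h3 : 'rV[R]_3) (m1 m2 : R) :
  m2 != 0 -> sqnorm (g2 - g1) != 0 -> sqnorm (g3 - g2) != 0 -> sqnorm (g0 - g3) != 0 ->
  h2 - h1 = (m2 / sqnorm (g2 - g1)) *: (g2 - g1) ->
  h3 - h2 = (m1 / sqnorm (g3 - g2)) *: (g3 - g2) ->
  qim (g2 - g0) *m qim (h3 - h1) = (m1 - m2)%:C%:M ->
  qim (g0 - g1) *m invmx (qim (g1 - g2)) *m qim (g2 - g3) *m invmx (qim (g3 - g0)) =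
  qreal (m1 / m2).
Proof.
move=> m0 n12 n23 n30 d12 d23 hfac.
have neg (a b : 'rV[R]_3) : qim (a - b) = - qim (b - a) :> 'M[C]_2 by rewrite -qimN opprB.
have negV (a b : 'rV[R]_3) : sqnorm (b - a) != 0 ->
    invmx (qim (a - b)) = - invmx (qim (b - a)).
  by move=> n0; rewrite -invmxN ?qim_unitmx// -qimN opprB.
have dualV (a b h h' : 'rV[R]_3) m : sqnorm (a - b) != 0 ->
    h - h' = (m / sqnorm (a - b)) *: (a - b) ->
    m%:C *: invmx (qim (a - b)) = - qim (h - h').
  by move=> n0 ->; rewrite invmx_qim// qimZ scalerA realcM realcV mulrN scaleNr.
apply: etrans (mulmx4N (neg _ _) (negV _ _ n12) (neg _ _) (negV _ _ n30)) _.
rewrite /qreal realcM realcV; apply: cross_ratio_of_dual.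
- by rewrite (inj_eq (@complexI R)).
- exact: qim_unitmx.
- exact: qim_unitmx.
- exact: qim_unitmx.
- have e : g1 - g0 + (g2 - g1) + (g3 - g2) + (g0 - g3) = 0.
    by rewrite !subr_chain subrr.
  by rewrite -(qim0 R) -e !qimD.
have -> : qim (g1 - g0) + qim (g2 - g1) = qim (g2 - g0) by rewrite -qimD subr_chain.
rewrite (dualV _ _ _ _ _ n12 d12) (dualV _ _ _ _ _ n23 d23).
have -> : - qim (h2 - h1) + - qim (h3 - h2) = - qim (h3 - h1).
  by rewrite -opprD -qimD subr_chain.
by rewrite mulmxN hfac -raddfN -realcN opprB realcD realcN.
Qed.

Lemma carg_scale (c : R) (z : C) : 0 < c -> carg (c%:C * z) = carg z.
Proof.
move=> c0; rewrite /carg; congr (xget _ _); apply/funext => t; apply/propext.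
have c0' : c%:C != 0 by rewrite (inj_eq (@complexI R)) gt_eqF.
have nc : `|c%:C * z| = c%:C * `|z| by rewrite normrM gtr0_norm// ltcR.
rewrite /= nc -mulrA; split=> -[ht hz]; split=> //; last by rewrite -hz.
exact: (mulfI c0').
Qed.

End QuaternionicQuad.

Lemma subr_path (V : zmodType) (a b c d : V) : d - a + (a - b) = d - c + (c - b).
Proof. by rewrite !addrA !subrK. Qed.

Lemma subr_shift (V : zmodType) (a b c : V) : a - b - (c - b) = a - c.
Proof. by rewrite opprB addrA subrK. Qed.

Lemma spec_ratio_carg (R : realType) (H : R) (a b l k k' : R[i]) :
  H != 0 -> l != 0 -> 0 < k -> 0 < k' ->
  - 4 * spec H a l / k = - 4 * spec H b l / k' -> carg a = carg b.
Proof.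
move=> hH l0 k0 k0' h.
have hH' : H%:C != 0 by rewrite (inj_eq (@complexI R)).
have kn : k != 0 by rewrite gt_eqF.
have kn' : k' != 0 by rewrite gt_eqF.
have c0 : - 4 * l ^+ 2 * H%:C != 0.
  by rewrite !mulf_neq0// ?expf_neq0// oppr_eq0 pnatr_eq0.
have hc : a^*%C = k / k' * b^*%C.
  apply: (mulfI c0); transitivity (k * (- 4 * spec H a l / k)).
    by rewrite /spec; field.
  by rewrite h /spec; field.
have kr : k / k' = (complex.Re (k / k'))%:C.
  by rewrite RRe_real// ger0_real// divr_ge0 ?ltW.
have ha : a = (complex.Re (k / k'))%:C * b.
  by apply: (can_inj (@conjcK R)); rewrite hc conjcM conjcR -kr.
by rewrite ha carg_scale// -ltcR -kr divr_gt0.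
Qed.

Section Surfaces.
Variables (R : realType) (D : quad_graph).
Local Notation C := R[i].
Variables (H : R) (alpha : dart D -> C) (Phi : vertex D -> C -> 'M[C]_2).
Hypotheses (hH : H != 0) (hPhi : extended_frame H alpha Phi).
Variables surf surf_dual : R -> vertex D -> 'rV[R]_3.
Hypothesis qim_surf : forall t v, qim (surf t v) = sym_family H (-1) (Phi v) t.
Hypothesis qim_surf_dual : forall t v, qim (surf_dual t v) = sym_family H 1 (Phi v) t.
Implicit Types (x : dart D) (v : vertex D) (t : R).

Lemma loop_vertex v : loopSU2 (Phi v).
Proof. by case: hPhi. Qed.

Lemma alpha_opp x : alpha (Defs.opp x) = alpha x.
Proof. by have [hl _ _ _ _] := hPhi; have [] := hl x. Qed.

Lemma alpha_nxt2 x : alpha (nxt (nxt x)) = alpha x.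
Proof. by have [hl _ _ _ _] := hPhi; have [] := hl x. Qed.

Lemma alpha_neq0 x : alpha x != 0.
Proof. by have [_ ha _ _ _] := hPhi; have [] := ha x. Qed.

Lemma alpha_regular x : `|sqrtC (H%:C * alpha x)| != 1.
Proof. by have [_ ha _ _ _] := hPhi; have [] := ha x. Qed.

Lemma edge_exists (e : oedge D) : exists u d : C, u != 0 /\
  edge_rel H (alpha e.1) u d (Phi (esrc e)) (Phi (etgt e)).
Proof. by have [_ _ _ _ he] := hPhi; exact: he. Qed.

Lemma surf_dual_dist t v : sqnorm (surf t v - surf_dual t v) = 1 / H ^+ 2.
Proof.
apply: (@complexI R); transitivity (\det (qim (surf t v - surf_dual t v))).
  by rewrite det_qim.
rewrite qimB qim_surf qim_surf_dual.
exact: sym_family_diff (loop_vertex v) hH.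
Qed.

Definition rho_dart t x := rho H (alpha x) t.

Lemma det_edge t (e : oedge D) :
  \det (1%:M + ('i%C * H%:C) *: (qim (surf t (etgt e) - surf_dual t (esrc e))
    - (rho_dart t e.1)%:C%:M)) =
  - 4 * spec H (alpha e.1) (expi t) / kappa2 H (alpha e.1) (expi t).
Proof.
have [u [d [hu he]]] := edge_exists e.
rewrite qimB qim_surf qim_surf_dual.
exact: (det_edge_from_dual hH (alpha_regular _) hu (loop_vertex _) (loop_vertex _) he).
Qed.

Section Dart.
Variable x : dart D.
Let v1 := org x.
Let v0 := org (nxt x).
Let v3 := org (nxt (nxt x)).
Let v2 := org (nxt (nxt (nxt x))).
Variable t : R.
Let p := rho_dart t x.
Let q := rho_dart t (nxt x).
Let f := surf t.
Let fs := surf_dual t.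

Lemma alpha_nxt3 : alpha (nxt (nxt (nxt x))) = alpha (nxt x).
Proof. by rewrite alpha_nxt2. Qed.

Lemma quad_closed : fs v3 - f v0 + (f v0 - fs v1) = fs v3 - f v2 + (f v2 - fs v1).
Proof. exact: subr_path. Qed.

Lemma dart_transport :
  (qim (fs v3 - f v0) - q%:C%:M) *m (qim (f v0 - fs v1) - p%:C%:M) =
  (qim (fs v3 - f v2) - p%:C%:M) *m (qim (f v2 - fs v1) - q%:C%:M).
Proof.
have [u0 [d0 [hu0 h0]]] := edge_exists (x, true).
have [u1 [d1 [hu1 h1]]] := edge_exists (nxt x, true).
have [u2 [d2 [hu2 h2]]] := edge_exists (nxt (nxt (nxt x)), false).
have [u3 [d3 [hu3 h3]]] := edge_exists (nxt (nxt x), false).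
rewrite /esrc /etgt /= nxt4 in h0 h1 h2 h3; rewrite alpha_nxt3 in h2; rewrite alpha_nxt2 in h3.
rewrite /f /fs !qimB !qim_surf !qim_surf_dual.
exact: (quad_transport hH (alpha_regular _) (alpha_regular _) hu0 hu1 hu2 hu3
  (loop_vertex _) (loop_vertex _) (loop_vertex _) (loop_vertex _) h0 h1 h2 h3).
Qed.

Let E := qreal (q - p) + qim (f v2 - f v0).

Let EE : E = qreal (q - p) + qim (f v2 - fs v1 - (f v0 - fs v1)).
Proof. by rewrite subr_shift. Qed.

Lemma dart_cmc_left : E *m qim (fs v3 - f v2) = qim (f v0 - fs v1) *m E.
Proof. by rewrite EE; exact: quat_transport quad_closed dart_transport. Qed.

Lemma dart_cmc_right : E *m qim (fs v3 - f v0) = qim (f v2 - fs v1) *m E.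
Proof.
have := quat_transport (esym quad_closed) (esym dart_transport).
have -> : qreal (p - q) + qim (f v0 - fs v1 - (f v2 - fs v1)) = - E.
  rewrite /E subr_shift opprD -(opprB q) /qreal realcN raddfN; congr (_ + _).
  by rewrite -qimN opprB.
by rewrite mulNmx mulmxN => /oppr_inj.
Qed.

Lemma dart_factor : E *m (qreal (q + p) + qim (fs v3 - fs v1)) =
  (qim (f v2 - fs v1) + q%:C%:M) *m (qim (f v2 - fs v1) + q%:C%:M)
  - (qim (f v0 - fs v1) + p%:C%:M) *m (qim (f v0 - fs v1) + p%:C%:M).
Proof.
rewrite -[fs v3 - fs v1](subr_shift _ (f v2)) -[in X in _ - X]opprB opprK.
by have := dart_cmc_left; rewrite EE; exact: quat_factor.
Qed.

Lemma dart_hyperedge_neq0 : E != 0.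
Proof.
apply/eqP => E0; have := congr1 determinant E0.
rewrite /E det_quat det0 => /complexI /eqP.
rewrite (paddr_eq0 (sqr_ge0 _) (sqnorm_ge0 _)) => /andP[].
rewrite sqrf_eq0 sqnorm_eq0 => /eqP/subr0_eq hpq /eqP/subr0_eq hf.
have d0 := det_edge t (x, true).
have d2 := det_edge t (nxt (nxt (nxt x)), false).
move: d0 d2; rewrite /esrc /etgt /= nxt4 /rho_dart alpha_nxt3.
have hpq' : rho H (alpha (nxt x)) t = rho H (alpha x) t := hpq.
have hf' : surf t (org (nxt (nxt (nxt x)))) = surf t (org (nxt x)) := hf.
rewrite hpq' hf' => ->.
have hl := norm_expi t; have l0 := expi_neq0 t.
have k0 := kappa2_gt0 (alpha_regular x) hl; have k1 := kappa2_gt0 (alpha_regular (nxt x)) hl.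
move=> /(spec_ratio_carg hH l0 (kappa2_gt0 (alpha_regular x) hl)
  (kappa2_gt0 (alpha_regular (nxt x)) hl)).
by have [_ _ /(_ x)/eqP] := hPhi.
Qed.

End Dart.
End Surfaces.

(** * The CMC pair *)

Section Turning.
Variable D : quad_graph.
Implicit Types (x : dart D) (v : vertex D).

Definition turn x := Defs.opp (nxt (nxt (nxt x))).

Lemma org_turn v x : interior_vertex v -> org x = v ->
  org (turn x) = v /\ org (nxt (turn x)) = org (nxt (nxt (nxt x))).
Proof.
move=> hv hx; have [_ h] := hv x hx; split; first by rewrite /turn org_opp// nxt4.
rewrite -org_opp /turn oppK// => h'; apply: h; exact/esym.
Qed.

Lemma interior_telescope (V : zmodType) (g : dart D -> V) v : interior_vertex v ->
  \sum_(x \in [set x | org x = v]) (g (turn x) - g x) = 0.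
Proof.
move=> hv; have fin := org_finite v.
rewrite fsbig_finite// sumrB -!fsbig_finite//.
rewrite -(reindex_fsbig turn [set x | org x = v] [set x | org x = v] g) ?subrr//.
split.
- by move=> x hx; have [] := org_turn hv hx.
- move=> x y _ _ /(congr1 (@Defs.opp D)); rewrite !oppK.
  by move=> /(congr1 (@nxt D)); rewrite !nxt4.
- move=> z hz; have [h _] := hv z hz; exists (nxt (Defs.opp z)).
    by rewrite /= -org_opp ?oppK// => h'; apply: h.
  by rewrite /turn nxt4 oppK.
Qed.

Lemma ext0_val (R : realType) (P : pred (vertex D)) (f : vertex D -> 'rV[R]_3) v :
  P v -> ext0 (fun w : {v | P v} => f (val w)) v = f v.
Proof. by move=> hP; rewrite /ext0 insubT. Qed.

End Turning.

Section Main.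
Variables (R : realType) (D : quad_graph).
Local Notation C := R[i].
Variables (H : R) (alpha : dart D -> C) (Phi : vertex D -> C -> 'M[C]_2).
Hypotheses (hH : H != 0) (hPhi : extended_frame H alpha Phi).
Variables surf surf_dual : R -> vertex D -> 'rV[R]_3.
Hypothesis qim_surf : forall t v, qim (surf t v) = sym_family H (-1) (Phi v) t.
Hypothesis qim_surf_dual : forall t v, qim (surf_dual t v) = sym_family H 1 (Phi v) t.
Implicit Types (x : dart D) (v : vertex D) (t : R).

Local Notation rho x t := (rho_dart H alpha t x).

Lemma cmc_pair_surf t :
  cmc_pair (fun v : primal_vertex D => surf t (val v))
           (fun v : dual_vertex D => surf_dual t (val v)).
Proof.
exists (fun x => rho (nxt x) t - rho x t), (fun x => rho (nxt x) t + rho x t).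
have F v : primal v -> ext0 (fun w : primal_vertex D => surf t (val w)) v = surf t v.
  exact: ext0_val.
have Fs v : ~~ primal v ->
    ext0 (fun w : dual_vertex D => surf_dual t (val w)) v = surf_dual t v.
  by move=> h; rewrite (ext0_val _ (P := fun v => ~~ primal v)).
have pr x : ~~ primal (org x) -> [/\ primal (org (nxt x)),
    ~~ primal (org (nxt (nxt x))) & primal (org (nxt (nxt (nxt x))))].
  by move=> h; rewrite !primal_nxt !negbK h.
have hyp x : ~~ primal (org x) ->
    hyperedge (fun w : primal_vertex D => surf t (val w))
      (fun x => rho (nxt x) t - rho x t) x =
    qreal (rho (nxt x) t - rho x t)
      + qim (surf t (org (nxt (nxt (nxt x)))) - surf t (org (nxt x))).
  by move=> h; have [h0 _ h2] := pr x h; rewrite /hyperedge !F.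
have hyps x : ~~ primal (org x) ->
    hyperedge_dual (fun w : dual_vertex D => surf_dual t (val w))
      (fun x => rho (nxt x) t + rho x t) x =
    qreal (rho (nxt x) t + rho x t)
      + qim (surf_dual t (org (nxt (nxt x))) - surf_dual t (org x)).
  by move=> h; have [_ h3 _] := pr x h; rewrite /hyperedge_dual !Fs.
split; first split.
- by move=> x _; rewrite /rho_dart !(alpha_nxt2 hPhi).
- by move=> x _; rewrite /rho_dart !(alpha_nxt2 hPhi).
- case=> v /= hv hint.
  pose g x := (qim (surf t (org (nxt x)) - surf_dual t (org x)) + (rho x t)%:C%:M)
    *m (qim (surf t (org (nxt x)) - surf_dual t (org x)) + (rho x t)%:C%:M).
  rewrite -[RHS](interior_telescope g hint); apply: eq_fsbigr => x.
  rewrite inE => /= hx; have hx' : ~~ primal (org x) by rewrite hx.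
  rewrite (hyp x hx') (hyps x hx') (dart_factor hH hPhi qim_surf qim_surf_dual).
  have [h1 h2] := org_turn hint hx.
  by rewrite /g h2 h1 -hx /rho_dart (alpha_opp hPhi) (alpha_nxt2 hPhi).
- move=> x hx; have [h0 h3 h2] := pr x hx.
  rewrite /= (hyp x hx) !F// !Fs//.
  have E0 := dart_hyperedge_neq0 hH hPhi qim_surf qim_surf_dual x t.
  have uE : (qreal (rho (nxt x) t - rho x t)
      + qim (surf t (org (nxt (nxt (nxt x)))) - surf t (org (nxt x)))) \in unitmx.
    by rewrite unitmxE unitfE det_quat_neq0.
  have hl := dart_cmc_left hH hPhi qim_surf qim_surf_dual x t.
  have hr := dart_cmc_right hH hPhi qim_surf qim_surf_dual x t.
  split; first exact: E0.
    by rewrite -mulmxA -hl mulKmx.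
  by rewrite -mulmxA -hr mulKmx.
Qed.

End Main.

(** * Real Hopf differential *)

Section RealHopf.
Variables (R : realType) (D : quad_graph).
Local Notation C := R[i].
Variables (H : R) (alpha : dart D -> C) (Phi : vertex D -> C -> 'M[C]_2).
Hypotheses (hH : H != 0) (hPhi : extended_frame H alpha Phi).
Variables surf surf_dual : R -> vertex D -> 'rV[R]_3.
Hypothesis qim_surf : forall t v, qim (surf t v) = sym_family H (-1) (Phi v) t.
Hypothesis qim_surf_dual : forall t v, qim (surf_dual t v) = sym_family H 1 (Phi v) t.
Hypothesis hreal : forall x, alpha x \is Num.real.
Implicit Types (x : dart D) (v : vertex D).

Local Notation f := (surf 0).
Local Notation fs := (surf_dual 0).
Local Notation K x := (complex.Re (kappa2 H (alpha x) 1)).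

Definition christoffel_mu x : R := 4 * complex.Re (alpha x) / (H * K x).
Local Notation mu := christoffel_mu.

Let expi0 : expi (0 : R) = 1.
Proof. by rewrite /expi cos0 sin0. Qed.

Let hH' : H%:C != 0. Proof. by rewrite (inj_eq (@complexI R)). Qed.

Let z0 : (0 : R)%:C%:M = 0 :> 'M[C]_2. Proof. exact: raddf0. Qed.

Let factor0 (E F : 'M[C]_2) (a b : 'rV[R]_3) (r s : R) : r = 0 -> s = 0 ->
  (qreal (r - s) + E) *m (qreal (r + s) + F) =
    (qim b + r%:C%:M) *m (qim b + r%:C%:M) - (qim a + s%:C%:M) *m (qim a + s%:C%:M) ->
  E *m F = (sqnorm a - sqnorm b)%:C%:M.
Proof.
move=> -> ->; rewrite subrr addr0 /qreal z0 !add0r !addr0 => ->.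
by rewrite !qim_sqr -raddfB; congr (_%:M); rewrite realcD realcN opprK addrC.
Qed.

Lemma alpha_Re x : (complex.Re (alpha x))%:C = alpha x.
Proof. exact: RRe_real (hreal x). Qed.

Lemma alpha_conj x : (alpha x)^*%C = alpha x.
Proof. by rewrite -alpha_Re conjcR. Qed.

Lemma K_gt0 x : 0 < K x.
Proof.
by rewrite -ltcR -kappa2_real ?normr1// kappa2_gt0 ?normr1//; exact: alpha_regular hPhi x.
Qed.

Lemma K_real x : (K x)%:C = kappa2 H (alpha x) 1.
Proof. by rewrite -kappa2_real// normr1. Qed.

Lemma spec_real x : spec H (alpha x) 1 = H%:C * alpha x.
Proof. by rewrite /spec alpha_conj expr1n mul1r. Qed.

Lemma rho_real x : rho H (alpha x) 0 = 0.
Proof.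
by rewrite /rho expi0 spec_real -alpha_Re -realcM /= mulr0 mul0r.
Qed.

Lemma mu_neq0 x : mu x != 0.
Proof.
rewrite /mu !mulf_neq0 ?invr_eq0 ?pnatr_eq0 ?mulf_neq0 ?(gt_eqF (K_gt0 x))//.
by rewrite -(inj_eq (@complexI R)) alpha_Re; exact: alpha_neq0 hPhi x.
Qed.

Lemma mu_labelling : labelling mu.
Proof. by move=> x; rewrite /mu (alpha_opp hPhi) (alpha_nxt2 hPhi). Qed.

Lemma muC x : (mu x)%:C = 4 * alpha x / (H%:C * kappa2 H (alpha x) 1).
Proof. by rewrite /mu !(realcM, realcV) realc_nat alpha_Re K_real. Qed.

Lemma real_edge_dual x (df := f (org (nxt x)) - f (org x)) :
  sqnorm df != 0 /\
  fs (org (nxt x)) - fs (org x) = (mu x / sqnorm df) *: df.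
Proof.
have [u [d [hu he]]] := edge_exists hPhi (x, true).
have inv1 : (expi (0 : R))^-1 = expi 0 by rewrite expi0 invr1.
have [h1 h2] : qim (fs (org (nxt x)) - fs (org x)) =
      (alpha x / (H%:C * (u * u^*%C))) *: qim df /\
    \det (qim df) = 4 * (u * u^*%C) / kappa2 H (alpha x) 1.
  rewrite /df !qimB !qim_surf !qim_surf_dual -[X in kappa2 _ _ X]expi0.
  exact: (frame_parallel hH (alpha_regular hPhi x) hu (loop_vertex hPhi _)
    (loop_vertex hPhi _) he (alpha_conj x) inv1 (rho_real x)).
have k0 : kappa2 H (alpha x) 1 != 0 by rewrite -K_real (inj_eq (@complexI R)) gt_eqF// K_gt0.
have uc : u^*%C != 0 by rewrite conjc_eq0.
rewrite det_qim in h2.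
have n0 : (sqnorm df)%:C != 0.
  by rewrite h2 !mulf_neq0 ?invr_eq0 ?pnatr_eq0.
split; first by rewrite -(inj_eq (@complexI R)).
apply: qim_inj; rewrite h1 qimZ realcM realcV muC h2; congr (_ *: _); field.
by rewrite hu uc k0 hH'.
Qed.

Lemma real_dist (e : oedge D) :
  sqnorm (f (etgt e) - fs (esrc e)) = 1 / H ^+ 2 + mu e.1.
Proof.
have := det_edge hH hPhi qim_surf qim_surf_dual 0 e.
rewrite /rho_dart rho_real expi0 spec_real z0 subr0.
move: (_ - _) => w.
have -> : \det (1%:M + ('i%C * H%:C) *: qim w) = 1 + ('i%C * H%:C) ^+ 2 * \det (qim w).
  by rewrite qimE !mx2E_rules; ring.
rewrite det_qim exprMn sqr_i => h.
have k0 : kappa2 H (alpha e.1) 1 != 0 by rewrite -K_real (inj_eq (@complexI R)) gt_eqF// K_gt0.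
apply: (@complexI R); rewrite realcD muC realcM realcV realcX realc1.
apply: (@mulfI _ (- 1 * H%:C ^+ 2)).
  by rewrite mulf_neq0 ?oppr_eq0 ?oner_eq0// expf_neq0.
apply: (addrI 1); rewrite h; field.
by rewrite k0 hH'.
Qed.

Lemma real_factor x :
  qim (f (org (nxt (nxt (nxt x)))) - f (org (nxt x)))
    *m qim (fs (org (nxt (nxt x))) - fs (org x)) = (mu x - mu (nxt x))%:C%:M.
Proof.
have := factor0 (rho_real _) (rho_real _) (dart_factor hH hPhi qim_surf qim_surf_dual x 0).
have d0 := real_dist (x, true); have d2 := real_dist (nxt (nxt (nxt x)), false).
rewrite /esrc /etgt /= in d0; rewrite /esrc /etgt /= nxt4 (mu_labelling (nxt x)).2 in d2.
by rewrite d0 d2 opprD addrACA subrr add0r.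
Qed.

Lemma mu_ratio_lt0 x : mu x / mu (nxt x) < 0.
Proof.
have r0 y : complex.Re (alpha y) != 0.
  by rewrite -(inj_eq (@complexI R)) alpha_Re; exact: alpha_neq0 hPhi y.
have h : complex.Re (alpha x) / complex.Re (alpha (nxt x)) < 0.
  rewrite ltNge; apply/negP; rewrite le_eqVlt eq_sym mulf_eq0 invr_eq0.
  rewrite (negPf (r0 _)) (negPf (r0 _)) /= => /(carg_scale (alpha (nxt x))).
  rewrite -[X in _ * X]alpha_Re -realcM divfK// !alpha_Re.
  by have [_ _ /(_ x)/eqP] := hPhi.
have -> : mu x / mu (nxt x) = complex.Re (alpha x) / complex.Re (alpha (nxt x))
    * (K (nxt x) / K x).
  by rewrite /mu; field; rewrite !r0 hH !gt_eqF ?K_gt0.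
by rewrite nmulr_rlt0// divr_gt0 ?K_gt0.
Qed.

Definition christoffel_k x := Num.sqrt `|mu x|.
Local Notation k := christoffel_k.

Lemma k_labelling : labelling k.
Proof. by move=> x; rewrite /k !(mu_labelling x).1 !(mu_labelling x).2. Qed.

Lemma k_ratio x : - (k x ^+ 2 / k (nxt x) ^+ 2) = mu x / mu (nxt x).
Proof.
by rewrite /k !sqr_sqrtr// -normf_div ltr0_norm ?mu_ratio_lt0// opprK.
Qed.

Lemma dual_sqnorm x (df := f (org (nxt x)) - f (org x)) :
  sqnorm (fs (org (nxt x)) - fs (org x)) = mu x ^+ 2 / sqnorm df.
Proof.
have [n0 ->] := real_edge_dual x; rewrite -/df in n0 *.
by rewrite sqnormZ; field.
Qed.

Lemma real_edge_dual_sym x (df := fs (org (nxt x)) - fs (org x)) :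
  sqnorm df != 0 /\ f (org (nxt x)) - f (org x) = (mu x / sqnorm df) *: df.
Proof.
have [n0 hd] := real_edge_dual x; rewrite /df dual_sqnorm; split.
  by rewrite mulf_neq0 ?invr_eq0 ?expf_neq0 ?mu_neq0.
rewrite hd scalerA -[LHS]scale1r; congr (_ *: _); field.
by rewrite n0 mu_neq0.
Qed.

(* Both surfaces have edges [- mu] times the inverse edges of the other, so the same
   argument gives the two cross ratios. *)
Lemma real_cross_ratio (g gs : vertex D -> 'rV[R]_3) x :
  (forall y (dg := g (org (nxt y)) - g (org y)), sqnorm dg != 0 /\
     gs (org (nxt y)) - gs (org y) = (mu y / sqnorm dg) *: dg) ->
  qim (g (org (nxt (nxt x))) - g (org x))
    *m qim (gs (org (nxt (nxt (nxt x)))) - gs (org (nxt x))) = (mu x - mu (nxt x))%:C%:M ->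
  cross_ratio g x = qreal (mu x / mu (nxt x)).
Proof.
move=> hdual hfac.
have [_ d1] := hdual (nxt x); have [_ d2] := hdual (nxt (nxt x)).
rewrite (mu_labelling x).2 in d2.
apply: dual_quad_cross_ratio d1 d2 hfac; first exact: mu_neq0.
- by have [] := hdual (nxt x).
- by have [] := hdual (nxt (nxt x)).
- by have [] := hdual (nxt (nxt (nxt x))); rewrite nxt4.
Qed.

Lemma real_isothermic_cross x : cross_ratio f x = qreal (mu x / mu (nxt x)).
Proof.
apply: (real_cross_ratio real_edge_dual).
have := real_factor (nxt x); rewrite nxt4 (mu_labelling x).2.
rewrite -(opprB (f _)) qimN mulNmx -(opprB (mu x)) realcN raddfN.
exact: oppr_inj.
Qed.

Lemma real_dual_isothermic_cross x : cross_ratio fs x = qreal (mu x / mu (nxt x)).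
Proof.
apply: (real_cross_ratio real_edge_dual_sym); apply: qim_comm_scalar.
exact: real_factor.
Qed.

Lemma cmc_param_of (g gs : vertex D -> 'rV[R]_3) :
  (forall y (dg := g (org (nxt y)) - g (org y)),
     gs (org (nxt y)) - gs (org y) = (mu y / sqnorm dg) *: dg) ->
  (forall x, cross_ratio g x = qreal (mu x / mu (nxt x))) ->
  (forall x, cross_ratio gs x = qreal (mu x / mu (nxt x))) ->
  (forall v, sqnorm (g v - gs v) = 1 / H ^+ 2) -> cmc_param H g gs.
Proof.
move=> hd hg hgs hn.
have iso (h : vertex D -> 'rV[R]_3) :
    (forall x, cross_ratio h x = qreal (mu x / mu (nxt x))) -> isothermic_param h.
  by move=> hc; exists k; [exact: k_labelling|move=> x _; rewrite k_ratio mu_ratio_lt0].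
split=> //; [exact: iso|split; first exact: iso].
exists mu; split=> // [|x]; [exact: mu_labelling|exact: mu_neq0].
Qed.

Lemma cmc_param_surf : cmc_param H f fs /\ cmc_param H fs f.
Proof.
have hd v : sqnorm (f v - fs v) = 1 / H ^+ 2.
  exact: (surf_dual_dist hH hPhi qim_surf qim_surf_dual 0 v).
split; apply: cmc_param_of.
- by move=> y; have [] := real_edge_dual y.
- exact: real_isothermic_cross.
- exact: real_dual_isothermic_cross.
- exact: hd.
- by move=> y; have [] := real_edge_dual_sym y.
- exact: real_dual_isothermic_cross.
- exact: real_isothermic_cross.
- by move=> v; rewrite -opprB sqnormN.
Qed.

End RealHopf.

Theorem theorem2p2 (R : realType) (D : quad_graph)
    (hsc : simply_connected D) (heven : even_graph D)
    (H : R) (hH : H != 0) (alpha : dart D -> R[i])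
    (Phi : vertex D -> R[i] -> 'M[R[i]]_2)
    (hPhi : extended_frame H alpha Phi) :
  exists f fs : R -> vertex D -> 'rV[R]_3,
    [/\ forall t v, qim (f t v) = sym_surface H (Phi v) t,
        forall t v, qim (fs t v) = sym_surface_dual H (Phi v) t,
        (forall x, alpha x \is Num.real) ->
          cmc_param H (f 0) (fs 0) /\ cmc_param H (fs 0) (f 0)
      & forall t, cmc_pair (fun v : primal_vertex D => f t (val v))
                           (fun v : dual_vertex D => fs t (val v))].
Proof.
have realf t v : qim (vec_of (sym_surface H (Phi v) t)) = sym_surface H (Phi v) t.
  rewrite vec_ofK// sym_surfaceE -(realcN 1).
  exact: imaginary_sym_family (loop_vertex hPhi v).
have realfs t v : qim (vec_of (sym_surface_dual H (Phi v) t)) = sym_surface_dual H (Phi v) t.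
  rewrite vec_ofK// sym_surface_dualE -realc1.
  exact: imaginary_sym_family (loop_vertex hPhi v).
exists (fun t v => vec_of (sym_surface H (Phi v) t)),
  (fun t v => vec_of (sym_surface_dual H (Phi v) t)).
have qf t v := etrans (realf t v) (sym_surfaceE H (Phi v) t).
have qfs t v := etrans (realfs t v) (sym_surface_dualE H (Phi v) t).
split=> // [hreal|t].
- exact: (@cmc_param_surf R D H alpha Phi hH hPhi _ _ qf qfs hreal).
- exact: (@cmc_pair_surf R D H alpha Phi hH hPhi _ _ qf qfs t).
Qed.
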